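(* Let $r\le n$, let $\mathbf{a}^1,\dots,\mathbf{a}^r$ be linearly independent vectors in $\mathbb{R}^n$, let $X\subset\mathbb{R}^n$ be a measurable set of finite positive Lebesgue measure, and let $f\in L_2(X)$. Let $Y=J(X)$ be an $r$-set. Then the error of approximation $E(f)=\inf_{g\in\mathcal{R}(\mathbf{a}^1,\dots,\mathbf{a}^r)}\|f-g\|_{L_2(X)}$ is given by $$E(f)=|\det J|^{-1/2}\left(\|f^*\|_{L_2(Y)}^2-\sum_{i=1}^r\frac1{|Y^{(i)}|^2}\|f_i^*\|_{L_2(Y)}^2+(r-1)\frac{A^2}{|Y|}\right)^{1/2}.$$
   Context: $\mathcal{R}(\mathbf{a}^1,\dots,\mathbf{a}^r)$ is the set of all sums $\sum_{i=1}^rg_i(\mathbf{a}^i\cdot\mathbf{x})$ with $g_i:\mathbb{R}\to\mathbb{R}$ such that each $g_i(\mathbf{a}^i\cdot\mathbf{x})\in L_2(X)$. Complete $\mathbf{a}^1,\dots,\mathbf{a}^r$ to a basis $\mathbf{a}^1,\dots,\mathbf{a}^n$ of $\mathbb{R}^n$, and let $J$ be the linear map $\mathbf{x}\mapsto\mathbf{y}$, $y_i=\mathbf{a}^i\cdot\mathbf{x}$, $i=1,\dots,n$; $\det J$ is its determinant. Put $Y=J(X)$, $Y_i=\{\mathbf{a}^i\cdot\mathbf{x}:\mathbf{x}\in X\}\subset\mathbb{R}$, and $f^*(\mathbf{y})=f(J^{-1}\mathbf{y})$ for $\mathbf{y}\in Y$. The set $Y$ is called an $r$-set if $Y=Y_1\times\dots\times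 Y_r\times Y_0$ for some set $Y_0\subset\mathbb{R}^{n-r}$ (if $r=n$ the factor $Y_0$ is absent). For $i=1,\dots,r$, $Y^{(i)}$ denotes the Cartesian product of the sets $Y_1,\dots,Y_r,Y_0$ with $Y_i$ omitted, and $d\mathbf{y}^{(i)}$ denotes integration over $Y^{(i)}$, i.e. over all coordinates of $\mathbf y$ except $y_i$. $|\cdot|$ denotes Lebesgue measure (in the appropriate dimension), and $$A=\int_Yf^*(\mathbf{y})\,d\mathbf{y},\qquad f_i^*(y_i)=\int_{Y^{(i)}}f^*(\mathbf{y})\,d\mathbf{y}^{(i)},\quad i=1,\dots,r.$$ In $\|f_i^*\|_{L_2(Y)}$ the function $f_i^*$ is regarded as a function of $\mathbf{y}\in Y$ depending only on $y_i$. *)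

(* Defs.v *)
From HB Require Import structures.
From mathcomp Require Import all_boot all_order all_algebra.
From mathcomp Require Import all_classical all_reals all_analysis.

Set Implicit Arguments.
Unset Strict Implicit.
Unset Printing Implicit Defensive.

Import Order.TTheory GRing.Theory Num.Theory.
Import numFieldNormedType.Exports.

Local Open Scope classical_set_scope.
Local Open Scope ring_scope.

Definition colvec_display : measure_display -> measure_display.
Proof. exact. Qed.

(* Vectors of R^n are column vectors, with the product sigma-algebra. *)
Section measurable_colvec.
Context {d} {T : measurableType d} (n : nat).

Let coord : 'I_n -> 'cV[T]_n -> T := fun i x => x i ord0.

Let colvec_set0 : g_sigma_preimage coord set0.
Proof. exact: sigma_algebra0. Qed.

Let colvec_setC A : g_sigma_preimage coord A -> g_sigma_preimage coord (~` A).
Proof. exact: sigma_algebraC. Qed.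

Let colvec_bigcup (F : _^nat) : (forall i, g_sigma_preimage coord (F i)) ->
  g_sigma_preimage coord (\bigcup_i (F i)).
Proof. exact: sigma_algebra_bigcup. Qed.

HB.instance Definition _ := @isMeasurable.Build (colvec_display d)
  'cV[T]_n (g_sigma_preimage coord) colvec_set0 colvec_setC colvec_bigcup.

Lemma measurable_coord (i : 'I_n) :
  measurable_fun [set: 'cV[T]_n] (fun x : 'cV[T]_n => x i ord0).
Proof.
move=> _ A mA; rewrite setTI; apply: sub_sigma_algebra => /=.
rewrite -bigcup_seq/=; exists i => /=; first by rewrite mem_index_enum.
by exists A => //; rewrite setTI.
Qed.

Lemma measurable_fun_colvec d1 (T1 : measurableType d1) (f : T1 -> 'cV[T]_n) :
  (forall i, measurable_fun [set: T1] (fun x => f x i ord0)) ->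
  measurable_fun [set: T1] f.
Proof.
move=> mf.
suff H : g_sigma_preimage (fun i x => f x i ord0) `<=` measurable.
  move=> _ A mA; rewrite setTI; apply: H.
  rewrite (g_sigma_preimage_comp coord f).
  by exists A => //; rewrite setTI.
apply: smallest_sub; first exact: sigma_algebra_measurable.
rewrite -bigcup_seq; apply: bigcup_sub => i _ _ [A mA <-].
exact: mf.
Qed.

End measurable_colvec.

(* The vector y with y_i = t whose other coordinates are, in order, those
   of z. *)
Definition insert_coord {T : Type} n (i : 'I_n) (t : T) (z : 'cV[T]_n.-1) :
    'cV[T]_n :=
  \col_k (if unlift i k is Some k' then z k' ord0 else t).

Section lebesgue_colvec.
Context {R : realType}.

Definition consv n (p : measurableTypeR R * 'cV[measurableTypeR R]_n) :
  'cV[measurableTypeR R]_n.+1 := insert_coord ord0 p.1 p.2.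

Definition unconsv n (x : 'cV[measurableTypeR R]_n.+1) :
    measurableTypeR R * 'cV[measurableTypeR R]_n :=
  (x ord0 ord0, \col_i x (lift ord0 i) ord0).

Lemma consvE0 n p : @consv n p ord0 ord0 = p.1.
Proof. by rewrite /consv /insert_coord mxE unlift_none. Qed.

Lemma consvES n p i : @consv n p (lift ord0 i) ord0 = p.2 i ord0.
Proof. by rewrite /consv /insert_coord mxE liftK. Qed.

Lemma consvK n : cancel (@consv n) (@unconsv n).
Proof.
move=> p; rewrite /unconsv consvE0 [RHS]surjective_pairing; congr pair.
by apply/matrixP => i j; rewrite mxE consvES (ord1 j).
Qed.

Lemma measurable_consv n : measurable_fun setT (@consv n).
Proof.
apply: measurable_fun_colvec => i.
have [j ->|->] := unliftP ord0 i.
  under eq_fun => p do rewrite (consvES p j).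
  exact: (measurableT_comp (measurable_coord j) measurable_snd).
by under eq_fun do rewrite consvE0; exact: measurable_fst.
Qed.

Lemma measurable_unconsv n : measurable_fun setT (@unconsv n).
Proof.
apply/measurable_fun_pairP; split; first exact: measurable_coord.
apply: measurable_fun_colvec => i.
under eq_fun do rewrite /= mxE.
exact: measurable_coord.
Qed.

Section succ.
Variable n : nat.
Variable mu : {sigma_finite_measure set 'cV[measurableTypeR R]_n -> \bar R}.

Definition lebesgue_succ : set 'cV[measurableTypeR R]_n.+1 -> \bar R :=
  pushforward (@lebesgue_measure R \x mu)%E (@consv n).

Let measure0 : lebesgue_succ set0 = 0%E.
Proof. by rewrite /lebesgue_succ /pushforward preimage_set0 measure0. Qed.

Let mpre A : measurable A -> measurable (@consv n @^-1` A).
Proof.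
by move=> mA; rewrite -[X in measurable X]setTI; exact: measurable_consv.
Qed.

Let measure_ge0 A : (0 <= lebesgue_succ A)%E.
Proof. by rewrite /lebesgue_succ /pushforward; exact: measure_ge0. Qed.

Let sigma_additive : semi_sigma_additive lebesgue_succ.
Proof.
move=> F mF tF mUF; rewrite /lebesgue_succ /pushforward preimage_bigcup.
apply: measure_semi_sigma_additive.
- by move=> i; exact: mpre.
- apply/trivIsetP => /= i j _ _ ij; rewrite -preimage_setI.
  by move/trivIsetP : tF => /(_ _ _ _ _ ij) ->//; rewrite preimage_set0.
- by rewrite -preimage_bigcup; exact: mpre.
Qed.

HB.instance Definition _ :=
  isMeasure.Build _ _ _ lebesgue_succ measure0 measure_ge0 sigma_additive.

Let sigma_finite_succ : sigma_finite setT lebesgue_succ.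
Proof.
have /sigma_finiteP[F [TF ndF Foo]] := sigma_finiteT (@lebesgue_measure R).
have /sigma_finiteP[G [TG ndG Goo]] := sigma_finiteT mu.
exists (fun k => @unconsv n @^-1` (F k `*` G k)).
  rewrite -preimage_bigcup (_ : \bigcup_k _ = setT) ?preimage_setT//.
  rewrite -subTset => -[t z] _.
  have [i _ Fi] : (\bigcup_k F k) t by rewrite -TF.
  have [j _ Gj] : (\bigcup_k G k) z by rewrite -TG.
  exists (maxn i j) => //; split => /=.
  - by move: Fi; exact/subsetPset/ndF/leq_maxl.
  - by move: Gj; exact/subsetPset/ndG/leq_maxr.
move=> k; have [mF Fk] := Foo k; have [mG Gk] := Goo k; split.
  rewrite -[X in measurable X]setTI; apply: measurable_unconsv => //.
  exact: measurableX.
rewrite /lebesgue_succ /pushforward -comp_preimage.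
rewrite (_ : _ \o _ = id); last by apply/funext => p /=; rewrite consvK.
rewrite preimage_id product_measure1E//.
by rewrite lte_mul_pinfty// ge0_fin_numE.
Qed.

HB.instance Definition _ :=
  @Measure_isSigmaFinite.Build _ _ _ lebesgue_succ sigma_finite_succ.

End succ.

(* The product of n copies of the one-dimensional Lebesgue measure, on the
   Borel sets of R^n. *)
Fixpoint borel_lebesgue n :
    {sigma_finite_measure set 'cV[measurableTypeR R]_n -> \bar R} :=
  match n with
  | 0 => dirac (const_mx 0 : 'cV[measurableTypeR R]_0)
  | m.+1 => lebesgue_succ (borel_lebesgue m)
  end.

End lebesgue_colvec.

Section statement_notions.
Context {R : realType}.

(* R^n with the sigma-algebra of Lebesgue measurable sets, obtained like that
   of [completed_lebesgue_measure]. *)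
Definition lebesgue_space n : Type :=
  caratheodory_type (mu_ext (@borel_lebesgue R n)).

Definition leb n : {measure set (lebesgue_space n) -> \bar R} :=
  @completed_measure_extension _ _ R (borel_lebesgue n).

Definition lebesgue_measurable n (D : set 'cV[R]_n) : Prop :=
  measurable (D : set (lebesgue_space n)).

Definition vol n (D : set 'cV[R]_n) : R := fine (leb n D).

Definition integral_over n (D : set 'cV[R]_n) (f : 'cV[R]_n -> R) : R :=
  \int[leb n]_(x in (D : set (lebesgue_space n))) f x.

(* A function on D is represented by a total function whose values outside D
   are irrelevant. *)
Definition L2norm n (D : set 'cV[R]_n) (f : 'cV[R]_n -> R) : \bar R :=
  ('N[leb n]_2%:E[EFin \o ((f \_ D)%R : lebesgue_space n -> R)])%E.

Definition L2 n (D : set 'cV[R]_n) : set ('cV[R]_n -> R) :=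
  [set f | ((f \_ D)%R : lebesgue_space n -> R) \in Lfun (leb n) 2%:E].

Definition dotv n (u : 'rV[R]_n) (x : 'cV[R]_n) : R := (u *m x) ord0 ord0.

Section ridge.
Variables (n r : nat) (r_le_n : (r <= n)%N).

(* The vectors a^1, ..., a^r are the rows of a. *)
Definition ridge_sums (a : 'M[R]_(r, n)) (X : set 'cV[R]_n) :
    set ('cV[R]_n -> R) :=
  [set g | exists2 h : 'I_r -> R -> R,
     forall i, L2 X (fun x => h i (dotv (row i a) x)) &
     g = fun x => \sum_(i < r) h i (dotv (row i a) x)].

Definition approx_error (a : 'M[R]_(r, n)) (X : set 'cV[R]_n)
    (f : 'cV[R]_n -> R) : \bar R :=
  ereal_inf [set L2norm X (fun x => f x - g x) | g in ridge_sums a X].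

(* y_i = b^i . x, where the b^i are the rows of the matrix b of the map. *)
Definition coord_map (b : 'M[R]_n) (x : 'cV[R]_n) : 'cV[R]_n := b *m x.

Definition pullback (b : 'M[R]_n) (f : 'cV[R]_n -> R) (y : 'cV[R]_n) : R :=
  f (invmx b *m y).

Definition projections (a : 'M[R]_(r, n)) (X : set 'cV[R]_n) (i : 'I_r) :
    set R :=
  [set dotv (row i a) x | x in X].

Definition tail_coords (y : 'cV[R]_n) : 'cV[R]_(n - r) :=
  \col_k y (cast_ord (subnKC r_le_n) (rshift r k)) ord0.

(* Y_1 x ... x Y_r x Y_0 *)
Definition rset_product (Ys : 'I_r -> set R) (Y0 : set 'cV[R]_(n - r)) :
    set 'cV[R]_n :=
  [set y : 'cV[R]_n | (forall j, Ys j (y (widen_ord r_le_n j) ord0)) /\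
           Y0 (tail_coords y)].

(* The same product without the factor Y_i. Inserting 0 as the i-th coordinate
   only restores the numbering of the others: that coordinate is not
   constrained. *)
Definition rset_product_omit (Ys : 'I_r -> set R) (Y0 : set 'cV[R]_(n - r))
    (i : 'I_r) : set 'cV[R]_n.-1 :=
  [set z : 'cV[R]_n.-1 | let y := insert_coord (widen_ord r_le_n i) 0 z in
           (forall j, j != i -> Ys j (y (widen_ord r_le_n j) ord0)) /\
           Y0 (tail_coords y)].

(* f_i^*, given Yi := Y^(i) and F := f^* *)
Definition marginal (i : 'I_r) (Yi : set 'cV[R]_n.-1) (F : 'cV[R]_n -> R)
    (t : R) : R :=
  integral_over Yi (fun z => F (insert_coord (widen_ord r_le_n i) t z)).

End ridge.

End statement_notions.

(* Main.v *)
(* On an r-set Y write P_i u for the integral of u over all coordinates but y_i.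
   By Fubini, P_i / |Y^(i)| is the orthogonal projection of L_2(Y) onto the
   functions of y_i, and it maps a function of y_j, j <> i, to a constant.
   Hence F - g0, where g0 is the sum of the P_i F / |Y^(i)| minus
   (r - 1) A / |Y|, is orthogonal to every ridge sum. As g0 is one of them, it is
   a best approximation, and the squared error is <F - g0, F>. The linear change
   of variables y = b x multiplies squared norms by |det b|. Lebesgue measurable
   functions are replaced by Borel functions equal to them off a Borel null set,
   to which Tonelli's theorem for products applies. *)

Require Import Defs.
From HB Require Import structures.
From mathcomp Require Import all_boot all_order all_algebra fingroup perm.
From mathcomp Require Import all_classical all_reals all_analysis.
From mathcomp Require Import measurable_realfun ring lra.

Set Implicit Arguments.
Unset Strict Implicit.
Unset Printing Implicit Defensive.

Import Order.TTheory GRing.Theory Num.Theory.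
Import numFieldNormedType.Exports.

Local Open Scope classical_set_scope.
Local Open Scope ring_scope.

(** Only [X] is assumed measurable: the factors $Y_i$ and $Y^{(i)}$ of the product are arbitrary
    sets. The measurability, finiteness and positivity of $Y^{(i)}$ are recovered from Fubini,
    because some good section of $Y$ equals $Y^{(i)}$. The sets $Y_i$ are never shown to be
    measurable. Statements about a slice integral therefore hold only for almost every $t$ lying in
    $Y_i$, and its measurability is established on $Y$, as a function of $y$, rather than on the
    line. A second obstacle is the completion: a section of a Lebesgue measurable function is
    measurable only for almost every $t$. Keeping exceptional sets Borel makes their own sections
    measurable, so that Tonelli shows almost all of them to be null. The constant $(r-1)A/|Y|$
    corrects a multiple count: each of the $r$ projections of $F$ has the mean $A/|Y|$ of $F$, and
    it may be kept only once. *)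

(** * Borel representatives in the completion of a sigma-finite measure *)

Section completion.
Context d (T : measurableType d) (R : realType).
Variable mu : {sigma_finite_measure set T -> \bar R}.

Notation cT := (caratheodory_type (mu_ext mu)).
Notation cmu := (@completed_measure_extension _ T R mu).

(** The exceptional set is measurable for [mu] itself, not just for its completion, so that Tonelli
    applies to it. *)
Definition eq_off (V : Type) (f g : T -> V) : Prop :=
  exists N : set T, [/\ measurable N, mu N = 0%E & forall x, ~ N x -> f x = g x].

Lemma completed_measureE (A : set T) : measurable A -> cmu A = mu A.
Proof. exact: measurable_mu_extE. Qed.

Lemma measurable_completion (A : set T) :
  measurable A -> measurable (A : set cT).
Proof. exact: caratheodory_measurable_mu_ext. Qed.

(** Covers of [E] whose total measure exceeds the infimum by at most 1/(k+1) are intersected over k.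
    If the outer measure is infinite, the whole space serves. *)
Lemma mu_ext_hull (E : set T) :
  exists G : set T, [/\ measurable G, E `<=` G & mu G = mu_ext mu E].
Proof.
have [Eoo|Efin] := eqVneq (mu_ext mu E) +oo%E.
  exists setT; split=> //; rewrite Eoo; apply/eqP.
  rewrite -leye_eq -Eoo -[in leRHS](measurable_mu_extE mu measurableT).
  exact: le_mu_ext.
have Efn : mu_ext mu E \is a fin_num.
  by rewrite ge0_fin_numE ?ltey// mu_ext_ge0.
have cov k : exists G : set T, [/\ measurable G, E `<=` G &
    (mu G <= mu_ext mu E + (k.+1%:R^-1)%:E)%E].
  have k0 : (0 < k.+1%:R^-1 :> R) by rewrite invr_gt0.
  have [_ [/= C [mC EC] <-] ltC] := lb_ereal_inf_adherent k0 Efn.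
  exists (\bigcup_j C j); split => //; first exact: bigcupT_measurable.
  apply: le_trans (ltW ltC).
  by apply: measure_sigma_subadditive => //; exact: bigcupT_measurable.
pose G_ k := projT1 (cid (cov k)).
have GP k : [/\ measurable (G_ k), E `<=` G_ k &
    (mu (G_ k) <= mu_ext mu E + (k.+1%:R^-1)%:E)%E].
  by rewrite /G_; case: cid.
have mG : measurable (\bigcap_k G_ k).
  by apply: bigcapT_measurable => k; case: (GP k).
exists (\bigcap_k G_ k); split => //.
  by move=> x Ex k _; case: (GP k) => _ + _; exact.
apply/eqP; rewrite eq_le; apply/andP; split; last first.
  rewrite -(measurable_mu_extE mu mG); apply: le_mu_ext.
  by move=> x Ex k _; case: (GP k) => _ + _; exact.
apply/lee_addgt0Pr => _/posnumP[e]; near \oo => k.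
apply: (@le_trans _ _ (mu (G_ k))).
  apply: le_measure; rewrite ?inE//; first by case: (GP k).
  exact: bigcap_inf.
case: (GP k) => _ _ /le_trans; apply; rewrite leeD2l// lee_fin ltW//.
by near: k; apply: near_infty_natSinv_lt.
Unshelve. all: by end_near. Qed.

(** On a piece [S k] of finite measure, the hull [B] of [A] exceeds [A] by a set of outer measure
    zero, which has a null hull in turn. Off the union of these null hulls, [A] is the union of the
    sets [B]. *)
Lemma completion_measurable_setP (A : set T) : measurable (A : set cT) ->
  exists N : set T, [/\ measurable N, mu N = 0%E & measurable (A `\` N)].
Proof.
move=> mA; have [S ST Soo] := sigma_finiteT mu.
have mS k : measurable (S k) by case: (Soo k).
have [NS NSP] : {N : nat -> set T & forall k, exists B : set T,
    [/\ measurable (N k), mu (N k) = 0%E, measurable B,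
        A `&` S k `<=` B & B `\` (A `&` S k) `<=` N k]}.
  apply: (@choice _ _ (fun k N => exists B : set T,
    [/\ measurable N, mu N = 0%E, measurable B,
        A `&` S k `<=` B & B `\` (A `&` S k) `<=` N])) => k.
  have mAS : measurable (A `&` S k : set cT).
    by apply: measurableI => //; exact: measurable_completion.
  have [B [mB AB BE]] := mu_ext_hull (A `&` S k).
  have [N [mN DN NE]] := mu_ext_hull (B `\` (A `&` S k)).
  (* Finiteness, inherited from [S k], allows the measures of [B] and of its part in [A] to be
     subtracted. *)
  have Boo : (cmu B < +oo)%E.
    rewrite completed_measureE// BE (le_lt_trans _ (Soo k).2)//.
    apply: le_trans (le_mu_ext mu (@subIsetr _ A (S k))) _.
    by rewrite (measurable_mu_extE mu (mS k)).
  exists N, B; split => //; rewrite NE.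
  have -> : mu_ext mu (B `\` (A `&` S k)) = cmu (B `\` (A `&` S k)) by [].
  rewrite measureD//; last exact: measurable_completion.
  rewrite setIidr// [X in (X - _)%E](_ : _ = mu_ext mu (A `&` S k)).
    apply: subee; rewrite ge0_fin_numE ?mu_ext_ge0// -BE.
    by rewrite -(completed_measureE mB).
  by rewrite -BE; exact: completed_measureE.
have mNS k : measurable (NS k) by have [? []] := NSP k.
have mB k : exists B : set T, [/\ measurable B, A `&` S k `<=` B &
    B `\` (A `&` S k) `<=` NS k] by have [B []] := NSP k; exists B.
have [B {}mB] := choice mB.
have mN : measurable (\bigcup_k NS k) by exact: bigcupT_measurable.
exists (\bigcup_k NS k); split => //.
  have : mu.-negligible (\bigcup_k NS k).
    apply: negligible_bigcup => k; exists (NS k); split=> //;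
    by have [? []] := NSP k.
  by move/negligibleP; exact.
rewrite (_ : A `\` _ = \bigcup_k B k `\` \bigcup_k NS k).
  by apply: measurableD => //; apply: bigcupT_measurable => k; case: (mB k).
apply/seteqP; split=> x [].
- move=> Ax Nx; split=> //.
  have [k _ Sx] : (\bigcup_k S k) x by rewrite -ST.
  by exists k => //; case: (mB k) => _ /(_ x) + _; apply.
- move=> [k _ Bx] Nx; split=> //; apply: contrapT => nA; apply: Nx.
  by exists k => //; case: (mB k) => _ _; apply; split => // -[].
Qed.

Lemma completion_null (E N : set T) : measurable N -> mu N = 0%E ->
  E `<=` N -> measurable (E : set cT) /\ cmu E = 0%E.
Proof.
move=> mN N0 EN.
have mE : measurable (E : set cT).
  have cc : measure_is_complete cmu by exact: measure_is_complete_caratheodory.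
  apply: cc; exists N; split=> //; first exact: measurable_completion.
  by rewrite -N0; exact: completed_measureE.
split=> //; apply/eqP; rewrite -measure_le0 -N0 -(completed_measureE mN).
by apply: le_measure; rewrite ?inE//; exact: measurable_completion.
Qed.

(** A preimage under [f] is a preimage under [g] off [N], plus a subset of the null set [N], which
    is measurable by completeness. *)
Lemma eq_off_measurable d' (V : measurableType d') (f g : T -> V) :
  eq_off f g -> measurable_fun setT g -> measurable_fun setT (f : cT -> V).
Proof.
move=> [N [mN N0 fg]] mg _ B mB; rewrite setTI.
have [mE _] := completion_null mN N0 (@subIsetr _ (f @^-1` B) N).
rewrite (_ : f @^-1` B = (g @^-1` B `\` N) `|` (f @^-1` B `&` N)).
  apply: measurableU => //; apply: measurable_completion.
  by apply: measurableD => //; rewrite -[g @^-1` B]setTI; exact: mg.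
apply/seteqP; split=> x /=.
- move=> Bfx; case: (pselect (N x)) => Nx; first by right.
  by left; split => //; rewrite /= -fg.
- by case=> [[Bg Nx]|[]//]; rewrite fg.
Qed.

(** Superlevel sets at rational heights are Borel up to null sets, and countably many null sets have
    a null union [M]. Off [M] every superlevel set is a countable union of rational ones, so [f]
    reset to 0 on [M] is Borel. *)
Lemma completion_measurable_funP (f : T -> R) :
  measurable_fun setT (f : cT -> R) ->
  exists2 g, measurable_fun setT g & eq_off f g.
Proof.
move=> mf.
have cut (q : rat) : exists N : set T, [/\ measurable N, mu N = 0%E &
    measurable ([set x | ratr q < f x] `\` N)].
  apply: completion_measurable_setP.
  have -> : [set x | ratr q < f x] = setT `&` (f : cT -> R) @^-1` `]ratr q, +oo[.
    by rewrite setTI; apply/seteqP; split=> x /=; rewrite in_itv/= andbT.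
  exact: mf.
have [N NP] := choice cut.
have N0' : mu.-negligible (\bigcup_q N q).
  (* The rationals are enumerated by their codes; a number that encodes no rational is sent to 0,
     which merely repeats [N 0]. *)
  rewrite (reindex_bigcup (fun n => odflt 0 (@unpickle rat n)) setT)//; last first.
    by move=> q _; exists (pickle q) => //; rewrite pickleK.
  apply: negligible_bigcup => k.
  by exists (N (odflt 0 (unpickle k))); case: (NP (odflt 0 (unpickle k))); split.
have mN : measurable (\bigcup_q N q).
  by apply: bigcupT_measurable_rat => q; case: (NP q).
have N0 : mu (\bigcup_q N q) = 0%E by move/negligibleP : N0'; exact.
set M := \bigcup_q N q in mN N0 N0'.
exists (f \_ (~` M)); last first.
  by exists M; split=> // x Mx; rewrite patchE mem_set.
suff H : measurable_fun (~` M) f.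
  by apply/(measurable_restrict _ _ _).1 => //; [exact: measurableC|rewrite setTI].
move=> mNM; apply: (measurability _ (RGenOInfty.measurableE R)) => // /= _ [_ [a ->] <-].
rewrite (_ : _ `&` _ =
    \bigcup_(q in [set q : rat | a < ratr q]) ([set x | ratr q < f x] `\` M)).
  rewrite bigcup_mkcond; apply: bigcupT_measurable_rat => q; case: ifPn => // _.
  case: (NP q) => mNq _ mDq.
  rewrite (_ : _ `\` M = ([set x | ratr q < f x] `\` N q) `\` M).
    exact: measurableD.
  apply/seteqP; split=> x [].
    by move=> fx Mx; split=> //; split=> // Nx; apply: Mx; exists q.
  by move=> [].
apply/seteqP; split=> x.
- move=> [Mx /=]; rewrite in_itv/= andbT => afx.
  have [q] := rat_in_itvoo afx; rewrite in_itv/= => /andP[aq qf].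
  by exists q.
- move=> [q /= aq [/= qf Mx]]; split=> //=; rewrite in_itv/= andbT.
  exact: lt_trans qf.
Qed.

Lemma measurable_from_completion :
  measurable_fun setT (fun x : cT => x : T).
Proof. by move=> _ B mB; rewrite setTI; exact: measurable_completion. Qed.

(** The identity from the completed space to the original one is measurable and pushes the completed
    measure forward to [mu]. *)
Lemma ge0_integral_completion_borel (g : T -> \bar R) :
  measurable_fun setT g -> (forall x, (0 <= g x)%E) ->
  (\int[cmu]_x g x = \int[mu]_x g x)%E.
Proof.
move=> mg g0.
have := ge0_integral_pushforward measurable_from_completion cmu measurableT
  mg (fun x _ => g0 x).
rewrite preimage_setT /= => <-.
apply: (eq_measure_integral mu) => [|/= _ A mA _].
  exact: measurable_from_completion.
exact: (completed_measureE mA).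
Qed.

Lemma integral_completion_borel (g : T -> \bar R) :
  measurable_fun setT g -> (\int[cmu]_x g x = \int[mu]_x g x)%E.
Proof.
move=> mg; rewrite integralE [RHS]integralE.
rewrite ge0_integral_completion_borel; [|exact: measurable_funepos|by []].
by rewrite ge0_integral_completion_borel; [|exact: measurable_funeneg|].
Qed.

Lemma eq_off_integral (f g : T -> \bar R) : eq_off f g ->
  measurable_fun setT g -> (\int[cmu]_x f x = \int[mu]_x g x)%E.
Proof.
move=> fg mg; rewrite -(integral_completion_borel mg).
apply: ae_eq_integral.
- exact: measurableT.
- exact: eq_off_measurable fg mg.
- exact: (measurableT_comp mg measurable_from_completion).
- have [N [mN N0 fgE]] := fg.
  exists N; split.
  + exact: measurable_completion.
  + by rewrite -N0; exact: completed_measureE.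
  + move=> x /= /not_implyP[_ neq]; apply: contrapT => Nx; apply: neq.
    by rewrite -fgE.
Qed.

End completion.

(** * Affine substitution on the real line *)

Section lebesgue_affine.
Context {R : realType}.
Notation lambda := (@lebesgue_measure R).

Lemma measurable_affine (c d : R) :
  measurable_fun setT (fun x : measurableTypeR R => c * x + d : measurableTypeR R).
Proof. by apply: measurable_funD => //; exact: measurable_funM. Qed.

(** By uniqueness of Lebesgue measure it suffices to compare both sides on half-open intervals. *)
Lemma lebesgue_measure_affine (c d : R) (A : set (measurableTypeR R)) :
  c != 0 -> measurable A ->
  (`|c|%:E * lambda ((fun x => (c * x + d)%R) @^-1` A) = lambda A)%E.
Proof.
move=> c0 mA.
have cp : 0 <= `|c| by [].
pose phi := fun x : measurableTypeR R => c * x + d : measurableTypeR R.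
pose nu := (mscale (NngNum cp) (pushforward lambda phi)
  : {measure set (measurableTypeR R) -> \bar R}).
have : forall X, ocitv X -> lambda X = nu (measurable_affine c d) X.
  move=> _ [[a b]] _ <- /=.
  rewrite /nu /mscale /= /pushforward.
  have [ab|ba] := ltP a b; last first.
    by rewrite set_itv_ge ?bnd_simp -?leNgt// preimage_set0 !measure0 mule0.
  rewrite lebesgue_measure_itv /= lte_fin ab -EFinD.
  have [cgt0|clt0] := ltP 0 c.
    rewrite (_ : _ @^-1` _ = `](a - d) / c, (b - d) / c]%classic); last first.
      apply/seteqP; split=> x /=; rewrite /phi !in_itv/= ltr_pdivrMr// ler_pdivlMr//;
        by move=> /andP[h1 h2]; apply/andP; split; lra.
    rewrite lebesgue_measure_itv /= lte_fin ltr_pM2r ?invr_gt0// ltrD2r ab.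
    rewrite -EFinD -EFinM gtr0_norm//; congr EFin; field.
    exact: lt0r_neq0.
  have {}clt0 : c < 0 by rewrite lt_neqAle c0.
  (* A negative slope swaps the endpoints, so the preimage is closed on the left; its length is
     unaffected. *)
  rewrite (_ : _ @^-1` _ = `[(b - d) / c, (a - d) / c[%classic); last first.
    apply/seteqP; split=> x /=; rewrite /phi !in_itv/= ltr_ndivlMr// ler_ndivrMr//;
      by move=> /andP[h1 h2]; apply/andP; split; lra.
  rewrite lebesgue_measure_itv /= lte_fin ltr_nM2r ?invr_lt0// ltrD2r ab.
  rewrite -EFinD -EFinM ltr0_norm//; congr EFin; field.
  by rewrite ltr0_neq0.
by move=> /lebesgue_measure_unique /(_ A mA) ->.
Qed.

Lemma ge0_integral_affine (c d : R) (f : measurableTypeR R -> \bar R) :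
  c != 0 -> measurable_fun setT f -> (forall x, 0 <= f x)%E ->
  (\int[lambda]_x f (c * x + d)%R = `|c|^-1%:E * \int[lambda]_x f x)%E.
Proof.
move=> c0 mf f0.
have cp : 0 <= `|c| by [].
pose phi := (fun x : measurableTypeR R => c * x + d : measurableTypeR R).
have mphi : measurable_fun setT phi by exact: measurable_affine.
have -> : (\int[lambda]_x f x = `|c|%:E * \int[lambda]_x f (c * x + d)%R)%E.
  pose nu := (pushforward lambda phi : {measure set (measurableTypeR R) -> \bar R}).
  transitivity (\int[mscale (NngNum cp) (nu mphi)]_x f x)%E.
    apply: eq_measure_integral => A mA _ /=.
    by rewrite -(lebesgue_measure_affine d c0 mA).
  rewrite ge0_integral_mscale//; congr (_ * _)%E.
  by rewrite (ge0_integral_pushforward mphi)// preimage_setT.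
by rewrite muleA -EFinM mulVf ?mul1e// normr_eq0.
Qed.

End lebesgue_affine.

(** * Tonelli, translations and block elimination for the Borel product measure *)

Section borel_lebesgue_integral.
Context {R : realType}.
Notation lambda := (@lebesgue_measure R).
Notation V n := ('cV[measurableTypeR R]_n).
Notation bleb n := (@borel_lebesgue R n).

Lemma measurable_addv n (v : 'cV[R]_n) :
  measurable_fun setT (fun x : V n => (x : 'cV[R]_n) + v : V n).
Proof.
apply: measurable_fun_colvec => i.
under eq_fun do rewrite mxE.
by apply: measurable_funD => //; exact: measurable_coord.
Qed.

Lemma measurable_mulmx m n (b : 'M[R]_(m, n)) :
  measurable_fun setT (fun x : V n => b *m (x : 'cV[R]_n) : V m).
Proof.
apply: measurable_fun_colvec => i.
under eq_fun do rewrite mxE.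
apply: measurable_sum => k; apply: measurable_funM => //.
exact: measurable_coord.
Qed.

Lemma measurable_cons n d (T : measurableType d) (f : T -> measurableTypeR R)
    (g : T -> V n) : measurable_fun setT f -> measurable_fun setT g ->
  measurable_fun setT (fun x => consv (f x, g x)).
Proof.
move=> mf mg; apply: (measurableT_comp (@measurable_consv _ n)).
exact: measurable_fun_pair.
Qed.

Lemma ge0_integral_lebesgue_succ n (f : V n.+1 -> \bar R) :
  measurable_fun setT f -> (forall x, 0 <= f x)%E ->
  (\int[bleb n.+1]_x f x = \int[lambda]_t \int[bleb n]_z f (consv (t, z)))%E.
Proof.
move=> mf f0.
rewrite -(@fubini_tonelli1 _ _ _ _ _ lambda (bleb n) (f \o @consv R n))//.
  rewrite /= /lebesgue_succ.
  by rewrite (ge0_integral_pushforward (@measurable_consv _ n))// preimage_setT.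
- exact: (measurableT_comp mf (@measurable_consv _ n)).
- by move=> x; exact: f0.
Qed.

Lemma ge0_integral_consC n (f : V n.+1 -> \bar R) :
  measurable_fun setT f -> (forall x, 0 <= f x)%E ->
  (\int[lambda]_t \int[bleb n]_z f (consv (t, z)) =
   \int[bleb n]_z \int[lambda]_t f (consv (t, z)))%E.
Proof.
move=> mf f0.
rewrite (@fubini_tonelli _ _ _ _ _ lambda (bleb n) (f \o @consv R n))//.
- exact: (measurableT_comp mf (@measurable_consv _ n)).
- by move=> x; exact: f0.
Qed.

Lemma measurable_consr n (f : V n.+1 -> \bar R) (t : R) :
  measurable_fun setT f -> measurable_fun setT (fun z => f (consv (t, z))).
Proof. by move=> mf; apply: (measurableT_comp mf); exact: measurable_cons. Qed.

Lemma consvD n (t : R) (z : 'cV[R]_n) (v : 'cV[R]_n.+1) :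
  consv (t, z) + v = consv (t + v ord0 ord0, z + \col_i v (lift ord0 i) ord0).
Proof.
apply/colP => i; rewrite mxE.
by have [j ->|->] := unliftP ord0 i; rewrite ?consvES ?consvE0 ?mxE.
Qed.

(** Induction on the dimension: the inner integral absorbs the tail of [v], and the affine
    substitution of slope 1 absorbs its first coordinate. *)
Lemma ge0_integral_translation n (v : 'cV[R]_n) (f : V n -> \bar R) :
  measurable_fun setT f -> (forall x, 0 <= f x)%E ->
  (\int[bleb n]_x f (x + v)%R = \int[bleb n]_x f x)%E.
Proof.
elim: n v f => [|n IH] v f mf f0.
  by apply: eq_integral => x _; congr f; apply/colP; case.
rewrite (ge0_integral_lebesgue_succ mf f0) ge0_integral_lebesgue_succ; first last.
- by move=> x; exact: f0.
- exact: (measurableT_comp mf (measurable_addv v)).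
under eq_integral do under eq_integral do rewrite consvD.
have m1 t : measurable_fun setT (fun z : V n => f (consv (t, z))).
  exact: measurable_consr.
under eq_integral do rewrite (IH _ (fun z => f (consv (_, z))))//.
transitivity (\int[lambda]_t (\int[bleb n]_z f (consv ((1 * t + v ord0 ord0)%R, z))))%E.
  by apply: eq_integral => t _; rewrite mul1r.
pose g (t : measurableTypeR R) := (\int[bleb n]_z f (consv (t, z)))%E.
rewrite (@ge0_integral_affine _ 1 _ g)//.
- by rewrite normr1 invr1 mul1e.
- apply: (measurable_fun_fubini_tonelli_F (m2 := bleb n) (f \o @consv R n)) => //.
  exact: (measurableT_comp mf (@measurable_consv _ n)).
- by move=> x; exact: f0.
- by move=> t; apply: integral_ge0 => z _; exact: f0.
Qed.

Lemma consv_col_mx n (t : R) (z : 'cV[R]_n) :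
  consv (t, z) = col_mx (t%:M : 'M[R]_1) z :> 'cV[R]_(1 + n).
Proof.
apply/colP => i; have [j ->|->] := unliftP ord0 i.
  by rewrite consvES -rshift1 col_mxEd.
rewrite consvE0; transitivity (col_mx (t%:M : 'M[R]_1) z (lshift n ord0) ord0).
  by rewrite col_mxEu mxE eqxx.
by congr (col_mx _ _ _ _); exact/val_inj.
Qed.

Lemma block_mx_consv n (al : R) (u : 'rV[R]_n) (c : 'cV[R]_n) (D : 'M[R]_n)
    (t : R) (z : 'cV[R]_n) :
  block_mx al%:M u c D *m (consv (t, z) : 'cV[R]_(1 + n)) =
  consv (al * t + (u *m z) ord0 ord0, t *: c + D *m z).
Proof.
rewrite !consv_col_mx mul_block_col mul_mx_scalar.
by rewrite raddfD /= scalar_mxM -mx11_scalar !mul_mx_scalar.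
Qed.

(** One step of block Gaussian elimination; the matrix on the right is the Schur complement of the
    pivot [al]. *)
Lemma det_block_pivot n (al : R) (u : 'rV[R]_n) (c : 'cV[R]_n) (D : 'M[R]_n) :
  al != 0 ->
  \det (block_mx (al%:M : 'M[R]_1) u c D) = al * \det (D - al^-1 *: (c *m u)).
Proof.
move=> al0; have -> : block_mx (al%:M : 'M[R]_1) u c D =
    block_mx 1%:M 0 (al^-1 *: c) 1%:M *m
    block_mx al%:M u 0 (D - al^-1 *: (c *m u)).
  rewrite mulmx_block !mul1mx !mul0mx !addr0.
  by rewrite mul_mx_scalar scalerA divff// scale1r -scalemxAl addrC subrK.
by rewrite det_mulmx det_lblock det_ublock !det1 det_scalar1 !mul1r.
Qed.

(** Named so that the elimination step can take the case of dimension [n] as a hypothesis. *)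
Definition linear_change_of_variables n := forall (b : 'M[R]_n) (f : V n -> \bar R),
  b \in unitmx -> measurable_fun setT f -> (forall x, 0 <= f x)%E ->
  (\int[bleb n]_x f (b *m (x : 'cV[R]_n) : V n) =
   `|\det b|^-1%:E * \int[bleb n]_x f x)%E.

(** For fixed [z] the first output coordinate s = al t + u z is affine in t. Taking s as the
    variable turns the other outputs into s c / al + S z, with [S] the Schur complement. For fixed s
    this is a linear map of dimension [n] followed by a translation. The factors |al| and |det S|
    multiply to |det b|. *)
Lemma linear_change_of_variables_pivot n (al : R) (u : 'rV[R]_n)
    (c : 'cV[R]_n) (D : 'M[R]_n) (b := block_mx (al%:M : 'M[R]_1) u c D)
    (f : V n.+1 -> \bar R) :
  linear_change_of_variables n -> al != 0 -> b \in unitmx ->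
  measurable_fun setT f -> (forall x, 0 <= f x)%E ->
  (\int[bleb n.+1]_x f (b *m (x : 'cV[R]_(1 + n)) : V n.+1) =
   `|\det b|^-1%:E * \int[bleb n.+1]_x f x)%E.
Proof.
move=> IH al0 bu mf f0.
set S := D - al^-1 *: (c *m u).
have detb : \det b = al * \det S by exact: det_block_pivot.
have Su : S \in unitmx.
  by move: bu; rewrite !unitmxE detb unitrM => /andP[].
have mfb : measurable_fun setT
    (fun x : V n.+1 => f (b *m (x : 'cV[R]_(1 + n)) : V n.+1)).
  exact: (measurableT_comp mf (measurable_mulmx _)).
rewrite (ge0_integral_lebesgue_succ mfb)//.
rewrite (ge0_integral_consC mfb)//.
(* [g (s, z)] is the image under [b] of the vector with tail [z] whose image has first coordinate
   s. *)
pose g (p : measurableTypeR R * V n) : V n.+1 :=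
  consv (p.1, al^-1 *: (p.1 *: c) + S *m (p.2 : 'cV[R]_n)).
have mg : measurable_fun setT g.
  apply: measurable_cons; first exact: measurable_fst.
  apply: measurable_fun_colvec => i.
  under eq_fun do rewrite !mxE.
  apply: measurable_funD.
    by do 2 (apply: measurable_funM => //).
  apply: measurable_sum => k; apply: measurable_funM => //.
  exact: (measurableT_comp (measurable_coord k) measurable_snd).
have mfg : measurable_fun setT (f \o g) by exact: (measurableT_comp mf mg).
transitivity (\int[bleb n]_z \int[lambda]_t
    (f \o g) ((al * t + (u *m (z : 'cV[R]_n)) ord0 ord0)%R, z))%E.
  apply: eq_integral => z _; apply: eq_integral => t _.
  rewrite block_mx_consv /g /=; congr (f (consv (_, _))).
  rewrite mulmxBl -!scalemxAl -mulmxA {2}[u *m z]mx11_scalar mul_mx_scalar.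
  rewrite scalerDl scalerDr !scalerA mulKf// -addrA; congr (_ + _).
  by rewrite addrCA subrr addr0.
have fg0 x : (0 <= (f \o g) x)%E by exact: f0.
have mfgl z : measurable_fun setT (fun t : measurableTypeR R => (f \o g) (t, z)).
  exact: (measurableT_comp mfg (measurable_pair2 z)).
under eq_integral => z _.
  rewrite (@ge0_integral_affine _ al _ (fun t => (f \o g) (t, z)) al0 (mfgl z));
    last by [].
  over.
have mI : measurable_fun setT
    (fun z : V n => \int[lambda]_t (f \o g) (t, z))%E.
  by apply: (measurable_fun_fubini_tonelli_G (m1 := lambda) (f \o g)).
have mJ : measurable_fun setT
    (fun t : measurableTypeR R => \int[bleb n]_z f (consv (t, z)))%E.
  apply: (measurable_fun_fubini_tonelli_F (m2 := bleb n) (f \o @consv R n)).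
  - exact: (measurableT_comp mf (@measurable_consv _ n)).
  - by move=> x; exact: f0.
rewrite ge0_integralZl//; last first.
  by move=> z _; apply: integral_ge0 => t _; exact: f0.
rewrite -(@fubini_tonelli _ _ _ _ _ lambda (bleb n) (f \o g))//.
transitivity (`|al|^-1%:E *
    \int[lambda]_t (`|\det S|^-1%:E * \int[bleb n]_z f (consv (t, z))))%E.
  congr (_ * _)%E; apply: eq_integral => t _.
  have mft : measurable_fun setT (fun z : V n => f (consv (t, z))).
    exact: measurable_consr.
  (* The translation is inserted on the right, so that the induction hypothesis for [S] can be
     applied to the translated integrand. *)
  rewrite -(@ge0_integral_translation n (al^-1 *: (t *: c)))//.
  rewrite -(IH S (fun z : V n =>
    f (consv (t, (z : 'cV[R]_n) + al^-1 *: (t *: c)))))//; last first.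
    exact: (measurableT_comp mft (measurable_addv _)).
  by apply: eq_integral => z _; rewrite /g /= [in LHS]addrC.
rewrite ge0_integralZl//; last first.
  by move=> t _; apply: integral_ge0.
by rewrite -ge0_integral_lebesgue_succ// muleA -EFinM detb normrM invfM.
Qed.

End borel_lebesgue_integral.

(** * Invertible linear maps, and Tonelli in an arbitrary coordinate *)

Section linear_change.
Context {R : realType}.
Notation lambda := (@lebesgue_measure R).
Notation V n := ('cV[measurableTypeR R]_n).
Notation bleb n := (@borel_lebesgue R n).

Lemma submx_pivot n (b : 'M[R]_(1 + n)) :
  b = block_mx ((b ord0 ord0)%:M : 'M[R]_1) (ursubmx b) (dlsubmx b) (drsubmx b).
Proof.
rewrite -[LHS]submxK; congr block_mx.
rewrite [LHS]mx11_scalar; congr (_%:M).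
by rewrite !mxE; congr (b _ _); exact/val_inj.
Qed.

Lemma unitmx_col0_neq0 n (b : 'M[R]_n.+1) : b \in unitmx ->
  exists i, b i ord0 != 0.
Proof.
move=> bu; apply: contrapT => /forallNP b0.
have : invmx b *m (b *m delta_mx ord0 ord0 : 'cV_n.+1) = 0.
  rewrite (_ : b *m _ = 0) ?mulmx0//; apply/colP => i.
  rewrite -colE !mxE; apply/eqP/negPn/negP; exact: b0.
rewrite mulKmx// => /colP /(_ ord0); rewrite !mxE !eqxx /= => /eqP.
by rewrite oner_eq0.
Qed.

(* When the pivot vanishes, add to the first row one that does not start
   with 0: this shear preserves the measure. *)
Lemma ge0_integral_linear n : @linear_change_of_variables R n.
Proof.
elim: n => [|n IH] b f bu mf f0.
  rewrite det_mx00 normr1 invr1 mul1e; apply: eq_integral => x _.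
  by congr f; apply/colP; case.
have pivot (d : 'M[R]_(1 + n)) (h : V n.+1 -> \bar R) : d ord0 ord0 != 0 ->
    d \in unitmx -> measurable_fun setT h -> (forall x, 0 <= h x)%E ->
    (\int[bleb n.+1]_x h (d *m (x : 'cV[R]_(1 + n)) : V n.+1) =
     `|\det d|^-1%:E * \int[bleb n.+1]_x h x)%E.
  move=> d0 du mh h0; rewrite (submx_pivot d).
  by apply: linear_change_of_variables_pivot => //; rewrite -submx_pivot.
have [b00|b00] := eqVneq (b ord0 ord0) 0; last exact: pivot.
have [i bi] := unitmx_col0_neq0 bu.
have [k ik|i0] := unliftP ord0 i; last by rewrite i0 b00 eqxx in bi.
(* Left multiplication by [E s] adds [s] times row [i] to the first row, so [E (-1)] undoes
   [E 1]. *)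
pose E (s : R) : 'M[R]_(1 + n) :=
  block_mx 1%:M (s *: delta_mx ord0 k) 0 1%:M.
have detE s : \det (E s) = 1 by rewrite det_ublock !det1 mulr1.
have Eu s : E s \in unitmx by rewrite unitmxE detE unitr1.
have EK : E (-1) *m E 1 = 1%:M.
  rewrite mulmx_block !mul1mx !mulmx1 !mul0mx !mulmx0 !addr0 add0r.
  by rewrite scaleN1r scale1r subrr -scalar_mx_block.
have E0 s : E s ord0 ord0 = 1.
  have -> : E s ord0 ord0 = E s (lshift n ord0) (lshift n ord0).
    by congr (E s _ _); exact/val_inj.
  by rewrite block_mxEul mxE eqxx.
pose c : 'M[R]_(1 + n) := E 1 *m b.
have cu : c \in unitmx by rewrite unitmx_mul Eu.
have detc : \det c = \det b by rewrite det_mulmx detE mul1r.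
have cE : c ord0 ord0 = b ord0 ord0 + b i ord0.
  have -> : c ord0 ord0 = c (lshift n ord0) ord0.
    by congr (c _ _); exact/val_inj.
  rewrite /c mxE big_split_ord /= big_ord1 block_mxEul mxE eqxx mul1r.
  congr (_ + _); first by congr (b _ _); exact/val_inj.
  rewrite (bigD1 k) //= big1 ?addr0 => [|j jk]; last first.
    by rewrite block_mxEur !mxE (negbTE jk) andbF mulr0 mul0r.
  rewrite block_mxEur !mxE !eqxx mulr1 mul1r ik; congr (b _ _).
  by rewrite rshift1.
have c00 : c ord0 ord0 != 0 by rewrite cE b00 add0r.
(* Since f (b x) = h (c x), the pivot case applies first to [c] and [h], then to [E (-1)] and [f];
   the corner entry of [E (-1)] is 1. *)
pose h (y : V n.+1) := f (E (-1) *m (y : 'cV[R]_(1 + n)) : V n.+1).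
have mh : measurable_fun setT h.
  exact: (measurableT_comp mf (measurable_mulmx _)).
transitivity (\int[bleb n.+1]_x h (c *m (x : 'cV[R]_(1 + n)) : V n.+1))%E.
  by apply: eq_integral => x _; rewrite /h /c !mulmxA EK mul1mx.
rewrite (pivot c h)//; last by move=> x; exact: f0.
congr (`|_|^-1%:E * _)%E; first exact: detc.
rewrite (pivot (E (-1)) f)//; last by rewrite E0 oner_eq0.
rewrite -[RHS]mul1e; congr (_%:E * _)%E.
transitivity (`|1 : R|^-1); last by rewrite normr1 invr1.
by congr (`|_|^-1); exact: detE.
Qed.

Lemma insert_coord_row_perm n (i : 'I_n.+1) (t : R) (z : 'cV[R]_n) :
  insert_coord i t z = row_perm (lift_perm i ord0 1%g) (consv (t, z)).
Proof.
apply/colP => k; rewrite [RHS]mxE [LHS]mxE.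
have [j ->|->] := unliftP i k.
  by rewrite lift_perm_lift perm1 consvES.
by rewrite lift_perm_id consvE0.
Qed.

Lemma measurable_insert_coord n (i : 'I_n.+1) : measurable_fun setT
  (fun p : measurableTypeR R * V n => insert_coord i p.1 p.2 : V n.+1).
Proof.
apply: measurable_fun_colvec => k; under eq_fun do rewrite mxE.
have [j _|_] := unliftP i k.
  exact: (measurableT_comp (measurable_coord j) measurable_snd).
exact: measurable_fst.
Qed.

(** Inserting at position [i] is inserting at position 0 and then permuting the coordinates; a
    permutation matrix has determinant 1 or -1. *)
Lemma ge0_integral_insert_coord n (i : 'I_n.+1) (f : V n.+1 -> \bar R) :
  measurable_fun setT f -> (forall x, 0 <= f x)%E ->
  (\int[bleb n.+1]_x f x =
   \int[lambda]_t \int[bleb n]_z f (insert_coord i t z))%E.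
Proof.
move=> mf f0; pose s := lift_perm i ord0 1%g.
have mfs : measurable_fun setT (fun x : V n.+1 =>
    f (perm_mx s *m (x : 'cV[R]_n.+1) : V n.+1)).
  exact: (measurableT_comp mf (measurable_mulmx _)).
transitivity (\int[bleb n.+1]_x
    f (perm_mx s *m (x : 'cV[R]_n.+1) : V n.+1))%E.
  rewrite ge0_integral_linear// ?unitmx_perm// det_perm normrX normrN1 expr1n.
  by rewrite invr1 mul1e.
rewrite (ge0_integral_lebesgue_succ mfs)//.
apply: eq_integral => t _; apply: eq_integral => z _.
by rewrite -row_permE insert_coord_row_perm.
Qed.

End linear_change.

(** * Tonelli and Fubini for Lebesgue measurable functions *)

Section lebesgue_fubini.
Context {R : realType}.
Notation lambda := (@lebesgue_measure R).
Notation V n := ('cV[measurableTypeR R]_n).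
Notation bleb n := (@borel_lebesgue R n).
Notation L n := (@lebesgue_space R n).

Lemma measurable_insert_coordr n (i : 'I_n.+1) (t : R) :
  measurable_fun setT (fun z : V n => insert_coord i t z : V n.+1).
Proof.
exact: (measurableT_comp (measurable_insert_coord i) (measurable_pair1 t)).
Qed.

Lemma measurable_insert_integral n (i : 'I_n.+1) (f : V n.+1 -> \bar R) :
  measurable_fun setT f -> (forall x, 0 <= f x)%E ->
  measurable_fun setT (fun t : measurableTypeR R =>
    \int[bleb n]_z f (insert_coord i t z))%E.
Proof.
move=> mf f0.
apply: (measurable_fun_fubini_tonelli_F (m2 := bleb n)
  (f \o (fun p => insert_coord i p.1 p.2))) => [|p]; last exact: f0.
exact: (measurableT_comp mf (measurable_insert_coord i)).
Qed.

Lemma integral_indic_insert n (i : 'I_n.+1) (A : set (V n.+1)) (t : R) :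
  measurable A ->
  (\int[bleb n]_z (\1_A (insert_coord i t z))%:E =
   bleb n [set z : V n | A (insert_coord i t z)])%E.
Proof.
move=> mA; rewrite -[X in _ = bleb n X]setIT -integral_indic//.
by have := measurable_insert_coordr i t measurableT mA; rewrite setTI.
Qed.

Lemma borel_lebesgue_insert n (i : 'I_n.+1) (A : set (V n.+1)) : measurable A ->
  bleb n.+1 A =
  (\int[lambda]_t bleb n [set z : V n | A (insert_coord i t z)])%E.
Proof.
move=> mA; rewrite -[A in LHS]setIT -integral_indic//.
have m1 : measurable_fun setT (EFin \o (\1_A : V n.+1 -> R)).
  by apply/measurable_EFinP; exact: measurable_indic.
rewrite (ge0_integral_insert_coord i m1); last by move=> x; rewrite lee_fin.
by apply: eq_integral => t _; exact: integral_indic_insert.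
Qed.

Lemma measurable_insert_section n (i : 'I_n.+1) (A : set (V n.+1)) :
  measurable A -> measurable_fun setT (fun t : measurableTypeR R =>
    bleb n [set z : V n | A (insert_coord i t z)]).
Proof.
move=> mA; under eq_fun do rewrite -integral_indic_insert//.
apply: (@measurable_insert_integral _ i (EFin \o (\1_A : V n.+1 -> R))).
  by apply/measurable_EFinP; exact: measurable_indic.
by move=> x; rewrite lee_fin.
Qed.

(** The section of this cylinder at $t$ is empty unless $t$ lies in the null set [M]. *)
Lemma null_coordinate n (i : 'I_n.+1) (M : set (measurableTypeR R)) :
  measurable M -> lambda M = 0%E ->
  measurable [set y : V n.+1 | M (y i ord0)] /\
  bleb n.+1 [set y : V n.+1 | M (y i ord0)] = 0%E.
Proof.
move=> mM M0.
have mA : measurable [set y : V n.+1 | M (y i ord0)].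
  by have := measurable_coord i measurableT mM; rewrite setTI.
split=> //; rewrite (borel_lebesgue_insert i mA).
rewrite (@ae_eq_integral _ _ _ lambda setT (cst 0%E)) ?integral0//.
- exact: measurable_insert_section.
- exists M; split=> // t /= /not_implyP[_ neq]; apply: contrapT => Mt.
  apply: neq; rewrite (_ : mkset _ = set0) ?measure0//.
  by apply/seteqP; split=> z //=; rewrite mxE unlift_none.
Qed.

(** The measures of the sections are nonnegative and integrate to 0. *)
Lemma ae_section_null n (i : 'I_n.+1) (N : set (V n.+1)) :
  measurable N -> bleb n.+1 N = 0%E ->
  {ae lambda, forall t, bleb n [set z : V n | N (insert_coord i t z)] = 0%E}.
Proof.
move=> mN N0.
have ms := measurable_insert_section i mN.
have [+ _] := ae_eq_integral_abs lambda measurableT ms.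
rewrite (_ : integral _ _ _ = 0%E).
  by move=> /(_ erefl); apply: filterS => t; exact.
rewrite -[RHS]N0 (borel_lebesgue_insert i mN).
by apply: eq_integral => t _; rewrite gee0_abs.
Qed.

Lemma ae_eq_off_section (U : Type) n (i : 'I_n.+1) (f g : V n.+1 -> U) :
  eq_off (bleb n.+1) f g ->
  {ae lambda, forall t, eq_off (bleb n)
    (fun z : V n => f (insert_coord i t z)) (fun z => g (insert_coord i t z))}.
Proof.
move=> [N [mN N0 fg]]; apply: filterS (ae_section_null i mN N0) => t Nt0.
exists [set z : V n | N (insert_coord i t z)]; split=> //.
  by have := measurable_insert_coordr i t measurableT mN; rewrite setTI.
by move=> z Nz; exact: fg.
Qed.

(** [Phi] integrates the sections of a Borel representative. It exists for every $t$ and is Borel,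
    whereas the sections of [u] are controlled only for almost every $t$. *)
Lemma lebesgue_tonelli n (i : 'I_n.+1) (u : L n.+1 -> R) :
  measurable_fun setT u -> (forall y, 0 <= u y) ->
  exists Phi : measurableTypeR R -> \bar R,
  [/\ measurable_fun setT Phi, forall t, (0 <= Phi t)%E,
      {ae lambda, forall t : measurableTypeR R,
        measurable_fun setT (fun z : L n => u (insert_coord i t z)) /\
        (\int[leb n]_(z in (setT : set (L n))) (u (insert_coord i t z))%:E = Phi t)%E} &
      (\int[leb n.+1]_(y in (setT : set (L n.+1))) (u y)%:E = \int[lambda]_t Phi t)%E].
Proof.
move=> mu_ u0; have [phi mphi uphi] := completion_measurable_funP mu_.
(* The representative may be negative on the null set; its absolute value still equals [u]
   elsewhere, since [u] is nonnegative. *)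
pose psi (y : V n.+1) : \bar R := `|phi y|%:E.
have mpsi : measurable_fun setT psi.
  by apply/measurable_EFinP; exact: measurableT_comp.
have psi0 y : (0 <= psi y)%E by rewrite lee_fin.
have upsi : eq_off (bleb n.+1) (EFin \o u) psi.
  case: uphi => N [mN N0 H]; exists N; split=> // x Nx.
  by rewrite /= /psi -H// ger0_norm.
exists (fun t => \int[bleb n]_z psi (insert_coord i t z))%E; split.
- exact: measurable_insert_integral.
- by move=> t; exact: integral_ge0.
- apply: filterS2 (ae_eq_off_section i uphi) (ae_eq_off_section i upsi).
  move=> t H1 H2; split.
    apply: eq_off_measurable H1 _.
    exact: (measurableT_comp mphi (measurable_insert_coordr i t)).
  apply: eq_off_integral H2 _.
  exact: (measurableT_comp mpsi (measurable_insert_coordr i t)).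
- rewrite -(ge0_integral_insert_coord i mpsi psi0).
  exact: eq_off_integral upsi mpsi.
Qed.

Lemma lebesgue_fubini n (i : 'I_n.+1) (u : L n.+1 -> R) :
  (leb n.+1).-integrable setT (EFin \o u) ->
  exists Phi : measurableTypeR R -> R,
  [/\ lambda.-integrable setT (EFin \o Phi),
      {ae lambda, forall t : measurableTypeR R,
        (leb n).-integrable setT (fun z : L n => (u (insert_coord i t z))%:E) /\
        \int[leb n]_(z in (setT : set (L n))) u (insert_coord i t z) = Phi t} &
      \int[leb n.+1]_(y in (setT : set (L n.+1))) u y = \int[lambda]_t Phi t].
Proof.
move=> iu.
have mu_ : measurable_fun setT u by apply/measurable_EFinP; exact: measurable_int iu.
(* [u] is the difference of the nonnegative integrable functions |u| and |u| - u, so the nonnegative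
   case suffices. *)
pose p (y : L n.+1) : R := `|u y|.
pose q (y : L n.+1) : R := p y - u y.
have ip : (leb n.+1).-integrable setT (EFin \o p) by exact: integrable_norm.
have iq : (leb n.+1).-integrable setT (EFin \o q).
  exact: (integrableB measurableT ip iu).
have p0 y : 0 <= p y by exact: normr_ge0.
have q0 y : 0 <= q y by rewrite subr_ge0 ler_norm.
have key (v : L n.+1 -> R) : (forall y, 0 <= v y) ->
    (leb n.+1).-integrable setT (EFin \o v) ->
  exists Phi : measurableTypeR R -> R,
  [/\ lambda.-integrable setT (EFin \o Phi),
      {ae lambda, forall t : measurableTypeR R,
        (leb n).-integrable setT (fun z : L n => (v (insert_coord i t z))%:E) /\
        \int[leb n]_(z in (setT : set (L n))) v (insert_coord i t z) = Phi t} &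
      \int[leb n.+1]_(y in (setT : set (L n.+1))) v y = \int[lambda]_t Phi t].
  move=> v0 iv.
  have mv : measurable_fun setT v.
    by apply/measurable_EFinP; exact: measurable_int iv.
  have [Psi [mPsi Psi0 aePsi intPsi]] := lebesgue_tonelli i mv v0.
  have iPsi : lambda.-integrable setT Psi.
    apply/integrableP; split=> //.
    under eq_integral do rewrite gee0_abs//.
    rewrite -intPsi.
    have /integrableP[_] := iv.
    by under eq_integral do rewrite gee0_abs ?lee_fin//.
  have fPsi : {ae lambda, forall t : measurableTypeR R, Psi t \is a fin_num}.
    by have := integrable_ae measurableT iPsi; apply: filterS => t; exact.
  (* [fine] sends infinite values to 0, but [Psi] is finite almost everywhere. *)
  have aeE : ae_eq lambda setT (EFin \o (fine \o Psi)) Psi.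
    by apply: filterS fPsi => t ft _; rewrite /= fineK.
  have mfPsi : measurable_fun setT (EFin \o (fine \o Psi)).
    by apply/measurable_EFinP; exact: measurableT_comp.
  have ifPsi : lambda.-integrable setT (EFin \o (fine \o Psi)).
    apply/integrableP; split=> //.
    have /integrableP[_] := iPsi; congr (_ < _)%E.
    apply: ae_eq_integral => //; try exact: measurableT_comp.
    by apply: filterS aeE => t /(_ I) /= Ht _ /=; rewrite -[in LHS]Ht.
  exists (fine \o Psi); split => //.
  - apply: filterS2 aePsi fPsi => t [mvt vtE] ft; split.
      apply/integrableP; split; first exact/measurable_EFinP.
      under eq_integral do rewrite gee0_abs ?lee_fin//.
      by rewrite vtE -ge0_fin_numE.
    by rewrite /Rintegral vtE.
  - rewrite /Rintegral intPsi; congr fine.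
    by apply: ae_eq_integral => //; apply: filterS aeE => t /[apply].
have [P [iP aeP intP]] := key p p0 ip.
have [Q [iQ aeQ intQ]] := key q q0 iq.
have uE y : u y = p y - q y by rewrite /q opprB addrC subrK.
exists (fun t => P t - Q t); split.
- exact: (integrableB measurableT iP iQ).
- apply: filterS2 aeP aeQ => t [ipt <-] [iqt <-]; split.
    under eq_fun do rewrite uE EFinB.
    exact: (integrableB measurableT ipt iqt).
  rewrite -RintegralB//.
  by apply: eq_Rintegral => z _; rewrite uE.
- rewrite RintegralB// -intP -intQ -RintegralB//.
  by apply: eq_Rintegral => z _; rewrite uE.
Qed.

End lebesgue_fubini.

(** * The inner product of square integrable functions on a set of finite measure *)

Section square_integrable.
Context d (T : measurableType d) (R : realType).
Variables (mu : {measure set T -> \bar R}) (D : set T).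
Hypotheses (mD : measurable D) (Dfin : (mu D < +oo)%E).
Implicit Types u v w : T -> R.

Definition sqint u : Prop :=
  measurable_fun D u /\ mu.-integrable D (fun x => (u x ^+ 2)%:E).

Definition dot u v : R := \int[mu]_(x in D) (u x * v x).

Lemma dotEFin u : sqint u ->
  (dot u u)%:E = (\int[mu]_(x in D) (u x ^+ 2)%:E)%E.
Proof.
move=> [_ iu]; rewrite /dot /Rintegral.
under eq_integral do rewrite -expr2.
by rewrite fineK//; exact: integrable_fin_num.
Qed.

Lemma sqint_eq u v : {in D, u =1 v} -> sqint u -> sqint v.
Proof.
move=> uv [mu_ iu]; split; first exact: eq_measurable_fun mu_.
by apply: eq_integrable iu => // x Dx; rewrite uv.
Qed.

Lemma eq_dot u u' v v' : {in D, u =1 u'} -> {in D, v =1 v'} ->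
  dot u v = dot u' v'.
Proof. by move=> uu vv; apply: eq_Rintegral => x Dx; rewrite uu// vv. Qed.

(** The doubled terms are those of the bound $(u+v)^2 \le 2u^2 + 2v^2$, from which closure under
    sums follows. *)
Lemma sqint_dominated u v (g : T -> R) : sqint v -> measurable_fun D u ->
  mu.-integrable D (EFin \o g) ->
  (forall x, D x -> u x ^+ 2 <= v x ^+ 2 *+ 2 + g x *+ 2) -> sqint u.
Proof.
move=> [mv iv] mu_ ig le; split=> //.
have iS : mu.-integrable D (fun x => (v x ^+ 2 *+ 2 + g x *+ 2)%:E).
  under eq_fun do rewrite EFinD -![(_ *+ 2)%:E]/((_ + _)%:E) !mulr2n !EFinD.
  by apply: integrableD => //; apply: integrableD.
apply: (le_integrable mD) iS.
  by apply/measurable_EFinP; exact: measurable_funX.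
move=> x Dx; rewrite !abse_EFin lee_fin ger0_norm ?sqr_ge0//.
exact: le_trans (le _ Dx) (ler_norm _).
Qed.

Lemma sqintD u v : sqint u -> sqint v -> sqint (fun x => u x + v x).
Proof.
move=> su sv; apply: (sqint_dominated su) (proj2 sv) _.
  by apply: measurable_funD; [case: su|case: sv].
by move=> x _; have := sqr_ge0 (u x - v x); nra.
Qed.

Lemma sqintZ c u : sqint u -> sqint (fun x => c * u x).
Proof.
move=> [mu_ iu]; split; first exact: measurable_funM.
under eq_fun do rewrite exprMn EFinM.
exact: integrableZl.
Qed.

Lemma integrable_cst_fin c : mu.-integrable D (fun=> c%:E).
Proof.
apply/integrableP; split=> //.
rewrite integral_cst// lte_mul_pinfty// ge0_fin_numE//.
Qed.

Lemma sqint_cst c : sqint (fun=> c).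
Proof. by split=> //; exact: integrable_cst_fin. Qed.

Lemma sqintB u v : sqint u -> sqint v -> sqint (fun x => u x - v x).
Proof.
move=> su /(sqintZ (-1)) sv; have := sqintD su sv.
by apply: sqint_eq => x _; rewrite mulN1r.
Qed.

Lemma sqint_sum (I : Type) (s : seq I) (F : I -> T -> R) :
  (forall i, sqint (F i)) -> sqint (fun x => \sum_(i <- s) F i x).
Proof.
move=> sF; elim: s => [|i s IH].
  by apply: sqint_eq (sqint_cst 0) => x _; rewrite big_nil.
by apply: sqint_eq (sqintD (sF i) IH) => x _; rewrite big_cons.
Qed.

(** The product is dominated by $u^2 + v^2$. *)
Lemma sqintM_integrable u v : sqint u -> sqint v ->
  mu.-integrable D (fun x => (u x * v x)%:E).
Proof.
move=> [mu_ iu] [mv iv].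
have iS : mu.-integrable D (fun x => (u x ^+ 2 + v x ^+ 2)%:E).
  under eq_fun do rewrite EFinD.
  exact: integrableD.
apply: (le_integrable mD) iS.
  by apply/measurable_EFinP; exact: measurable_funM.
move=> x Dx; rewrite !abse_EFin lee_fin.
rewrite [leRHS]ger0_norm ?addr_ge0 ?sqr_ge0// ler_norml.
have := sqr_ge0 (u x - v x); have := sqr_ge0 (u x + v x).
by have := sqr_ge0 (u x); have := sqr_ge0 (v x); move=> *; apply/andP; split; nra.
Qed.

Lemma sqint_integrable u : sqint u -> mu.-integrable D (EFin \o u).
Proof.
move=> su; have := sqintM_integrable su (sqint_cst 1).
by apply: eq_integrable => // x _; rewrite mulr1.
Qed.

Lemma dotC u v : dot u v = dot v u.
Proof. by apply: eq_Rintegral => x _; rewrite mulrC. Qed.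

Lemma dotDl u v w : sqint u -> sqint v -> sqint w ->
  dot (fun x => u x + v x) w = dot u w + dot v w.
Proof.
move=> su sv sw; rewrite /dot -RintegralD//; last 2 first.
- exact: sqintM_integrable.
- exact: sqintM_integrable.
by apply: eq_Rintegral => x _; rewrite mulrDl.
Qed.

Lemma dotZl c u w : sqint u -> sqint w -> dot (fun x => c * u x) w = c * dot u w.
Proof.
move=> su sw; rewrite /dot -RintegralZl//; last exact: sqintM_integrable.
by apply: eq_Rintegral => x _; rewrite mulrA.
Qed.

Lemma dotBl u v w : sqint u -> sqint v -> sqint w ->
  dot (fun x => u x - v x) w = dot u w - dot v w.
Proof.
move=> su sv sw; rewrite /dot -RintegralB//; last 2 first.
- exact: sqintM_integrable.
- exact: sqintM_integrable.
by apply: eq_Rintegral => x _; rewrite mulrBl.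
Qed.

Lemma dotBr u v w : sqint u -> sqint v -> sqint w ->
  dot w (fun x => u x - v x) = dot w u - dot w v.
Proof. by move=> *; rewrite dotC dotBl// ![dot _ w]dotC. Qed.

Lemma dot_suml (I : Type) (s : seq I) (F : I -> T -> R) w :
  (forall i, sqint (F i)) -> sqint w ->
  dot (fun x => \sum_(i <- s) F i x) w = \sum_(i <- s) dot (F i) w.
Proof.
move=> sF sw; elim: s => [|i s IH].
  rewrite big_nil /dot -[RHS](mul0r (fine (mu D))) -Rintegral_cst//.
  by apply: eq_Rintegral => x _; rewrite big_nil mul0r.
rewrite big_cons -IH -dotDl//; last exact: sqint_sum.
by apply: eq_dot => // x _; rewrite big_cons.
Qed.

Lemma dot_ge0 u : 0 <= dot u u.
Proof. by apply: Rintegral_ge0 => x _; rewrite -expr2 sqr_ge0. Qed.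

Lemma dot_cstr u c : sqint u -> dot u (fun=> c) = c * dot u (fun=> 1).
Proof.
by move=> su; rewrite dotC (dotC u) -dotZl//; [|exact: sqint_cst];
  apply: eq_dot => // x _; rewrite mulr1.
Qed.

Lemma dot11 : dot (fun=> 1) (fun=> 1) = fine (mu D).
Proof.
rewrite -[RHS]mul1r -Rintegral_cst//.
by apply: eq_Rintegral => x _; rewrite mulr1.
Qed.

(* The variance of u on D is nonnegative. *)
Lemma sqr_Rintegral_le u : 0 < fine (mu D) -> sqint u ->
  (\int[mu]_(x in D) u x) ^+ 2 <= fine (mu D) * \int[mu]_(x in D) u x ^+ 2.
Proof.
set m := fine (mu D) => m0 su.
rewrite (_ : \int[mu]_(x in D) u x = dot u (fun=> 1)); last first.
  by apply: eq_Rintegral => x _; rewrite mulr1.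
rewrite (_ : \int[mu]_(x in D) u x ^+ 2 = dot u u); last first.
  by apply: eq_Rintegral => x _; rewrite expr2.
(* [c] is the mean value of [u]. *)
set s := dot u _; pose c (x : T) : R := s / m.
have sc : sqint c by exact: sqint_cst.
have s1 : sqint (fun=> 1) by exact: sqint_cst.
have : 0 <= dot (fun x => u x - c x) (fun x => u x - c x) by exact: dot_ge0.
rewrite !(dotBl, dotBr)//; try exact: sqintB.
have cE v : sqint v -> dot v c = s / m * dot v (fun=> 1) by exact: dot_cstr.
rewrite (dotC c u) !cE// (dotC c) cE// dot11 -/s -/m => H.
have {}H : 0 <= (dot u u - s ^+ 2 / m) * m.
  rewrite mulr_ge0 ?(ltW m0)//; apply: le_trans H _; rewrite le_eqVlt.
  by apply/orP; left; apply/eqP; field; exact: lt0r_neq0.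
by move: H; rewrite mulrBl -mulrA mulVf ?lt0r_neq0// mulr1 subr_ge0 mulrC.
Qed.

(** Pythagoras: the two sides differ by the squared norm of g0 - g. Since F - g0 is orthogonal to
    g0, the left side is its squared norm. *)
Lemma dot_orthogonal_le (F g0 g : T -> R) : sqint F -> sqint g0 -> sqint g ->
  dot (fun x => F x - g0 x) g = 0 -> dot (fun x => F x - g0 x) g0 = 0 ->
  dot (fun x => F x - g0 x) F <= dot (fun x => F x - g x) (fun x => F x - g x).
Proof.
move=> sF s0 sg; rewrite !(dotBl, dotBr)//; try exact: sqintB.
move=> e1 e2.
have : 0 <= dot (fun x => g0 x - g x) (fun x => g0 x - g x) by exact: dot_ge0.
rewrite !(dotBl, dotBr)//; try exact: sqintB.
by rewrite (dotC g g0) (dotC g F) (dotC g0 F) in e1 e2 *; lra.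
Qed.

End square_integrable.

(** * [L2] and [L2norm] in terms of the inner product *)

Section L2_sqint.
Context {R : realType}.
Notation L n := (@lebesgue_space R n).
Implicit Types n : nat.

Lemma patch_sqr (T : Type) (D : set T) (v : T -> R) x :
  (v \_ D) x ^+ 2 = ((fun y => v y ^+ 2) \_ D) x.
Proof. by rewrite !patchE; case: ifP => // _; rewrite expr0n. Qed.

Lemma Lnorm2E n (D : set (L n)) (v : L n -> R) :
  ('N[leb n]_2%:E[EFin \o (v \_ D)] =
   (\int[leb n]_(x in D) (v x ^+ 2)%:E) `^ 2^-1)%E.
Proof.
rewrite unlock [in RHS]integral_mkcond; congr (_ `^ _)%E.
apply: eq_integral => x _ /=; rewrite powR_mulrn// -normrX ger0_norm ?sqr_ge0//.
by rewrite restrict_EFin patch_sqr.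
Qed.

Lemma L2P n (D : set (L n)) (v : L n -> R) : measurable D ->
  L2 D v <-> sqint (leb n) D v.
Proof.
move=> mD; rewrite /L2 /=; split.
- move=> /[dup] /Lfun2_integrable_sqr iv; rewrite inE => /andP[]; rewrite inE => /= mv _.
  split; first exact: (measurable_restrictT v mD).2.
  apply/integrable_mkcond => //; apply: eq_integrable iv => // x _.
  by rewrite restrict_EFin /= patch_sqr.
- move=> [mv iv]; rewrite inE; apply/andP; split; rewrite inE /=.
    exact: (measurable_restrictT v mD).1.
  rewrite /finite_norm Lnorm2E poweR_lty//.
  have /integrableP[_] := iv.
  by under eq_integral do rewrite gee0_abs ?lee_fin ?sqr_ge0//.
Qed.

Lemma L2normE n (D : set (L n)) (v : L n -> R) : measurable D ->
  sqint (leb n) D v -> L2norm D v = (Num.sqrt (dot (leb n) D v v))%:E.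
Proof.
move=> mD sv; rewrite /L2norm Lnorm2E -dotEFin//.
by rewrite poweR_EFin powR12_sqrt// dot_ge0.
Qed.

End L2_sqint.

(** * Linear change of variables for the completed measure *)

Section lebesgue_linear.
Context {R : realType}.
Notation V n := ('cV[measurableTypeR R]_n).
Notation L n := (@lebesgue_space R n).
Notation bleb n := (@borel_lebesgue R n).
Variables (n : nat) (b : 'M[R]_n).
Hypothesis bu : b \in unitmx.

Let lin (x : L n) : L n := b *m (x : 'cV[R]_n).

(** Preimages of null sets are null, by the change of variables applied to an indicator. This is
    what makes composition with an invertible linear map preserve Lebesgue measurability. *)
Lemma eq_off_linear (U : Type) (f g : V n -> U) : eq_off (bleb n) f g ->
  eq_off (bleb n) (fun x => f (lin x)) (fun x => g (lin x)).
Proof.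
move=> [N [mN N0 fg]]; exists (lin @^-1` N); split; last by move=> x; exact: fg.
  by have := measurable_mulmx b measurableT mN; rewrite setTI.
have mlN : measurable (lin @^-1` N : set (V n)).
  by have := measurable_mulmx b measurableT mN; rewrite setTI.
rewrite -[X in bleb n X]setIT -integral_indic//.
have := @ge0_integral_linear R n b (EFin \o (\1_N : V n -> R)) bu.
have -> : (\int[bleb n]_x (EFin \o (\1_N : V n -> R)) x = 0)%E.
  by rewrite /= integral_indic// setIT.
rewrite mule0; apply.
- by apply/measurable_EFinP; exact: measurable_indic.
- by move=> x; rewrite lee_fin.
Qed.

Lemma measurable_fun_lebesgue_linear (u : L n -> R) :
  measurable_fun setT u -> measurable_fun setT (fun x => u (lin x)).
Proof.
move=> /completion_measurable_funP[phi mphi /eq_off_linear H].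
apply: eq_off_measurable H _.
exact: (measurableT_comp mphi (measurable_mulmx b)).
Qed.

Lemma measurable_lebesgue_linear (A : set (L n)) :
  measurable A -> measurable (lin @^-1` A).
Proof.
move=> /(measurable_indicP R) /measurable_fun_lebesgue_linear H.
exact/(measurable_indicP R).
Qed.

Lemma ge0_integral_lebesgue_linear (u : L n -> R) :
  measurable_fun setT u -> (forall x, 0 <= u x) ->
  (\int[leb n]_x (u (lin x))%:E = `|\det b|^-1%:E * \int[leb n]_x (u x)%:E)%E.
Proof.
move=> mu_ u0; have [phi mphi uphi] := completion_measurable_funP mu_.
pose psi (y : V n) : \bar R := `|phi y|%:E.
have mpsi : measurable_fun setT psi.
  by apply/measurable_EFinP; exact: measurableT_comp.
have upsi : eq_off (bleb n) (EFin \o u) psi.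
  case: uphi => N [mN N0 H]; exists N; split=> // x Nx.
  by rewrite /= /psi -H// ger0_norm.
have := eq_off_integral (eq_off_linear upsi).
move=> /(_ (measurableT_comp mpsi (measurable_mulmx b))) => ->.
rewrite ge0_integral_linear//; last by move=> y; rewrite lee_fin.
congr (_ * _)%E.
exact/esym/(eq_off_integral upsi mpsi).
Qed.

End lebesgue_linear.

(** * Integration over all coordinates but one, on a set that splits off that coordinate *)

Section coordinate_slices.
Context {R : realType}.
Notation lambda := (@lebesgue_measure R).
Notation V n := ('cV[measurableTypeR R]_n).
Notation L n := (@lebesgue_space R n).
Notation bleb n := (@borel_lebesgue R n).
Variables (n : nat) (i : 'I_n.+1).
Variables (Y : set (L n.+1)) (T : set R) (W : set (L n)).
Hypotheses (mY : measurable Y) (Yfin : (leb n.+1 Y < +oo)%E)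
  (Ypos : (0 < leb n.+1 Y)%E).
Hypothesis YE : forall t z, Y (insert_coord i t z) <-> T t /\ W z.

Lemma patch_insert_in (u : L n.+1 -> R) t z : T t ->
  (u \_ Y) (insert_coord i t z) = ((fun z => u (insert_coord i t z)) \_ W) z.
Proof.
move=> Tt; rewrite !patchE; congr (if _ then _ else _).
by apply/idP/idP; rewrite !inE => H; [have [] := (YE t z).1 H|apply/YE].
Qed.

Lemma patch_insert_out (u : L n.+1 -> R) t z : ~ T t ->
  (u \_ Y) (insert_coord i t z) = 0.
Proof. by move=> Tt; rewrite patchE memNset// => /YE[]. Qed.

(** The section of [Y] at any t in [T] is exactly [W]. By Tonelli some section is measurable with
    finite positive measure; being nonempty, it lies over a point of [T]. *)
Lemma slice_measurable :
  [/\ measurable W, (leb n W < +oo)%E & (0 < leb n W)%E].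
Proof.
have [Phi [mPhi Phi0 aePhi intPhi]] := @lebesgue_tonelli R n i \1_Y
  ((measurable_indicP R Y).1 mY) (fun y => ler0n _ _).
have intE : (\int[lambda]_t Phi t = leb n.+1 Y)%E.
  by rewrite -intPhi integral_indic// setIT.
have iPhi : lambda.-integrable setT Phi.
  apply/integrableP; split=> //.
  by under eq_integral do rewrite gee0_abs//; rewrite intE.
(* Otherwise [Phi], which is finite almost everywhere, would vanish almost everywhere and [Y] would
   be null. *)
have [t [mt tE Phit0 Phitoo]] : exists t, [/\
    measurable_fun setT (fun z : L n => (\1_Y (insert_coord i t z) : R)),
    (\int[leb n]_(z in setT) (\1_Y (insert_coord i t z))%:E)%E = Phi t,
    (0 < Phi t)%E & (Phi t < +oo)%E].
  apply: contrapT => /forallNP H.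
  suff : (\int[lambda]_t Phi t = 0)%E.
    by rewrite intE => Y0; move: Ypos; rewrite Y0 ltxx.
  rewrite -(integral0 lambda setT); apply: ae_eq_integral => //.
  apply: filterS2 aePhi (integrable_ae measurableT iPhi) => t [mt tE] /(_ I) ft _.
  apply: contrapT => /eqP Pt; apply: (H t); split => //.
    by rewrite lt0e Pt Phi0.
  by rewrite ltey_eq ft.
have Tt : T t.
  apply: contrapT => nT; move: Phit0; rewrite -tE integral0_eq ?ltxx// => z _.
  by rewrite indicE memNset// => /YE[].
have WE : (fun z : L n => \1_Y (insert_coord i t z)) = \1_W :> (L n -> R).
  apply/funext => z; rewrite !indicE; congr (_%:R); congr nat_of_bool.
  by apply/idP/idP; rewrite !inE => H; [have [] := (YE t z).1 H|apply/YE].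
have mW : measurable W by apply/(measurable_indicP R); rewrite -WE.
have WPhi : leb n W = Phi t.
  rewrite -tE -[in LHS](setIT W) -integral_indic//; apply: eq_integral => z _.
  by rewrite -WE.
by split=> //; rewrite WPhi.
Qed.

Let mW : measurable W. Proof. by case: slice_measurable. Qed.
Let Wfin : (leb n W < +oo)%E. Proof. by case: slice_measurable. Qed.

(** [marginal] unfolds to this, so results about it transfer to $f_i^*$ by conversion. *)
Definition slice_integral (u : L n.+1 -> R) (t : R) : R :=
  \int[leb n]_(z in W) u (insert_coord i t z).

Lemma vol_slice_gt0 : 0 < fine (leb n W).
Proof. by have [_ ? ?] := slice_measurable; rewrite fine_gt0//; apply/andP. Qed.

Lemma Rintegral_insert (u : L n.+1 -> R) t : T t ->
  \int[leb n]_(z in setT) (u \_ Y) (insert_coord i t z) = slice_integral u t.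
Proof.
move=> Tt; rewrite /slice_integral [RHS]Rintegral_mkcond.
by apply: eq_Rintegral => z _; rewrite patch_insert_in.
Qed.

Lemma sqint_patch_integrable (u : L n.+1 -> R) : sqint (leb n.+1) Y u ->
  (leb n.+1).-integrable setT (EFin \o (u \_ Y)).
Proof.
move=> /(sqint_integrable mY Yfin) /(integrable_mkcond _ mY).1.
by rewrite restrict_EFin.
Qed.

(** Outside [T] the slice integral reads values of [u] off [Y], which are unconstrained. Hence it is
    matched with a Borel function only at points of [T]. *)
Lemma ae_slice_integral (u : L n.+1 -> R) : sqint (leb n.+1) Y u ->
  exists2 Phi : measurableTypeR R -> R, measurable_fun setT Phi &
  {ae lambda, forall t : measurableTypeR R, T t ->
    slice_integral u t = Phi t /\
    (leb n).-integrable W (fun z => (u (insert_coord i t z))%:E)}.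
Proof.
move=> /sqint_patch_integrable /(@lebesgue_fubini R n i).
move=> [Phi [iPhi aePhi _]]; exists Phi.
  by apply/measurable_EFinP; exact: measurable_int iPhi.
apply: filterS aePhi => t [it <-] Tt; rewrite Rintegral_insert//; split=> //.
pose us (z : L n) : R := u (insert_coord i t z).
have : (leb n).-integrable setT (EFin \o (us \_ W)).
  by apply: eq_integrable it => // z _; rewrite /= patch_insert_in.
by rewrite -restrict_EFin => /(integrable_mkcond _ mW).2.
Qed.

Lemma ae_coordinate (Q : measurableTypeR R -> Prop) : {ae lambda, forall t, Q t} ->
  exists N : set (V n.+1), [/\ measurable N, bleb n.+1 N = 0%E &
    forall y, ~ N y -> Q (y i ord0)].
Proof.
move=> [N [mN N0 QN]]; have [mM M0] := null_coordinate i mN N0.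
exists [set y | N (y i ord0)]; split=> // y Ny.
by apply: contrapT => nQ; apply: Ny; exact: QN.
Qed.

Lemma insert_coordK (y : L n.+1) :
  insert_coord i (y i ord0) (\col_k y (lift i k) ord0) = y.
Proof.
apply/colP => k; rewrite mxE.
by have [j ->|->] := unliftP i k; rewrite ?mxE.
Qed.

Lemma slice_coordinate (y : L n.+1) : Y y -> T (y i ord0).
Proof. by rewrite -{1}(insert_coordK y) => /YE[]. Qed.

Lemma measurable_slice_integral (u : L n.+1 -> R) : sqint (leb n.+1) Y u ->
  measurable_fun setT
    ((fun y : L n.+1 => slice_integral u (y i ord0)) \_ Y).
Proof.
move=> /ae_slice_integral[Phi mPhi /ae_coordinate[N [mN N0 NP]]].
have m1 : measurable_fun setT (\1_Y : L n.+1 -> R).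
  exact/measurable_indicP.
have [phi mphi [M [mM M0 MP]]] := completion_measurable_funP m1.
(* The Borel function [phi] stands for the indicator of [Y]; multiplying by it confines the
   comparison to points whose coordinate lies in [T]. *)
pose g (y : V n.+1) : R := Phi (y i ord0) * phi y.
have mg : measurable_fun setT g.
  apply: measurable_funM => //.
  exact: (measurableT_comp mPhi (measurable_coord i)).
apply: eq_off_measurable mg; exists (N `|` M); split.
- exact: measurableU.
- by rewrite measureU0.
move=> y /not_orP[Ny My]; rewrite /g -MP// indicE patchE.
case: ifPn => [/set_mem Yy|_]; last by rewrite mulr0.
by rewrite mulr1; apply: (NP _ Ny _).1; exact: slice_coordinate.
Qed.

(** Cauchy-Schwarz on [W]. When the square is not integrable on the slice, the right side is
    infinite because [W] has positive measure. *)
Lemma slice_integral_sqr_le (u : L n.+1 -> R) (t : R) :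
  (leb n).-integrable W (fun z => (u (insert_coord i t z))%:E) ->
  ((slice_integral u t ^+ 2)%:E <= leb n W *
    \int[leb n]_(z in W) (u (insert_coord i t z) ^+ 2)%:E)%E.
Proof.
move=> iu; set I := (\int[leb n]_(z in W) _)%E.
have I0 : (0 <= I)%E by apply: integral_ge0 => z _; rewrite lee_fin sqr_ge0.
have [Ioo|Ifin] := eqVneq I +oo%E.
  by rewrite Ioo gt0_muley ?leey//; case: slice_measurable.
pose us (z : L n) := u (insert_coord i t z).
have su : sqint (leb n) W us.
  have mus : measurable_fun W us by apply/measurable_EFinP; exact: measurable_int iu.
  split=> //; apply/integrableP; split.
    by apply/measurable_EFinP; exact: measurable_funX.
  under eq_integral do rewrite gee0_abs ?lee_fin ?sqr_ge0//.
  by rewrite ltey.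
have := sqr_Rintegral_le mW Wfin vol_slice_gt0 su; rewrite -lee_fin.
move=> /le_trans; apply; rewrite EFinM fineK; last first.
  by rewrite ge0_fin_numE//; exact: Wfin.
by rewrite /Rintegral fineK// ge0_fin_numE// ltey.
Qed.

Lemma sqint_slice_integral (u : L n.+1 -> R) : sqint (leb n.+1) Y u ->
  sqint (leb n.+1) Y (fun y => slice_integral u (y i ord0)).
Proof.
move=> su; have mf := measurable_slice_integral su.
pose f (y : L n.+1) : R := slice_integral u (y i ord0).
have mu1 : measurable_fun setT (u \_ Y).
  by apply/(measurable_restrictT _ mY); case: su.
have [Psi [mPsi Psi0 aePsi intPsi]] := lebesgue_tonelli i
  (measurable_funX 2%N mf) (fun y => sqr_ge0 _).
have [Psi' [mPsi' Psi'0 aePsi' intPsi']] := lebesgue_tonelli i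
  (measurable_funX 2%N mu1) (fun y => sqr_ge0 _).
have [Phi _ aePhi] := ae_slice_integral su.
have wf : leb n W = (fine (leb n W))%:E by rewrite fineK// ge0_fin_numE.
have w0 := vol_slice_gt0.
have int_sqr (v : L n.+1 -> R) :
    (\int[leb n.+1]_(y in setT) ((v \_ Y) y ^+ 2)%:E =
     \int[leb n.+1]_(y in Y) (v y ^+ 2)%:E)%E.
  rewrite [RHS]integral_mkcond; apply: eq_integral => y _.
  by rewrite restrict_EFin /= patch_sqr.
have slice_sqr (v : L n.+1 -> R) t : T t ->
    (\int[leb n]_(z in setT) ((v \_ Y) (insert_coord i t z) ^+ 2)%:E =
     \int[leb n]_(z in W) (v (insert_coord i t z) ^+ 2)%:E)%E.
  move=> Tt; rewrite [RHS]integral_mkcond; apply: eq_integral => z _.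
  by rewrite restrict_EFin /= patch_insert_in// patch_sqr.
split; first by apply/(measurable_restrictT _ mY).
apply/integrableP; split.
  apply/measurable_EFinP/measurable_funX.
  by apply/(measurable_restrictT _ mY).
under eq_integral do rewrite gee0_abs ?lee_fin ?sqr_ge0//.
rewrite -int_sqr intPsi.
(* One factor |W| comes from Cauchy-Schwarz, the other from integrating over [W] a function constant
   there. *)
apply: (@le_lt_trans _ _ (\int[lambda]_t ((fine (leb n W) ^+ 2)%:E * Psi' t))%E).
  apply: ae_ge0_le_integral => //.
  - by move=> t _; rewrite mule_ge0// lee_fin sqr_ge0.
  - exact: measurable_funeM.
  - apply: filterS3 aePsi aePsi' aePhi => t [_ E1] [_ E2] H _.
    have [Tt|Tt] := pselect (T t); last first.
      rewrite -E1 integral0_eq ?mule_ge0 ?lee_fin ?sqr_ge0// => z _.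
      by rewrite patch_insert_out// expr0n.
    have [_ iu] := H Tt; have := slice_integral_sqr_le iu.
    rewrite -E1 slice_sqr// -E2 slice_sqr//.
    set I := (\int[leb n]_(z in W) (u _ ^+ 2)%:E)%E.
    under eq_integral do rewrite [X in slice_integral _ X]mxE unlift_none.
    rewrite integral_cst// => le.
    rewrite (expr2 (fine (leb n W))) (EFinM (fine (leb n W))) -!wf -muleA muleC.
    exact: lee_wpmul2l.
rewrite ge0_integralZl//.
rewrite -intPsi' int_sqr lte_mul_pinfty ?lee_fin ?sqr_ge0//.
have [_ /integrableP[_]] := su.
by under eq_integral do rewrite gee0_abs ?lee_fin ?sqr_ge0//.
Qed.

(** On almost every slice over t in [T], both integrands have integral |W| h(t) times the slice
    integral of [u]. With h depending on $y_i$ only, this is the projection property of the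
    normalized slice integral. *)
Lemma dot_slice_integral (u : L n.+1 -> R) (h : R -> R) :
  sqint (leb n.+1) Y u -> sqint (leb n.+1) Y (fun y => h (y i ord0)) ->
  dot (leb n.+1) Y (fun y => slice_integral u (y i ord0)) (fun y => h (y i ord0)) =
  fine (leb n W) * dot (leb n.+1) Y u (fun y => h (y i ord0)).
Proof.
move=> su sh; have sP := sqint_slice_integral su.
pose a (y : L n.+1) : R := u y * h (y i ord0).
pose c (y : L n.+1) : R := slice_integral u (y i ord0) * h (y i ord0).
have ia : (leb n.+1).-integrable setT (EFin \o (a \_ Y)).
  rewrite -restrict_EFin; apply: (integrable_mkcond _ mY).1.
  exact: sqintM_integrable.
have ic : (leb n.+1).-integrable setT (EFin \o (c \_ Y)).
  rewrite -restrict_EFin; apply: (integrable_mkcond _ mY).1.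
  exact: sqintM_integrable.
have [Pa [iPa aePa intPa]] := lebesgue_fubini i ia.
have [Pc [iPc aePc intPc]] := lebesgue_fubini i ic.
have [Phi _ aePhi] := ae_slice_integral su.
rewrite /dot [LHS]Rintegral_mkcond [in RHS]Rintegral_mkcond -/a -/c intPa intPc.
rewrite -RintegralZl// /Rintegral; congr fine; apply: ae_eq_integral => //.
- exact: measurable_int iPc.
- apply/measurable_EFinP/measurable_funM => //.
  by apply/measurable_EFinP; exact: measurable_int iPa.
apply: filterS3 aePa aePc aePhi => t [_ <-] [_ <-] H _; congr EFin.
have [Tt|Tt] := pselect (T t); last first.
  rewrite (@eq_Rintegral _ _ _ _ setT (cst 0)); last first.
    by move=> z _; rewrite patch_insert_out.
  rewrite [in RHS](@eq_Rintegral _ _ _ _ setT (cst 0)); last first.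
    by move=> z _; rewrite patch_insert_out.
  by rewrite /Rintegral integral0 mulr0.
have [_ iu] := H Tt.
rewrite !Rintegral_insert// /slice_integral.
transitivity (\int[leb n]_(z in W) (slice_integral u t * h t)).
  by apply: eq_Rintegral => z _; rewrite /c mxE unlift_none.
rewrite Rintegral_cst// mulrC; congr (_ * _).
rewrite /slice_integral -RintegralZr//.
by apply: eq_Rintegral => z _; rewrite /a mxE unlift_none.
Qed.

End coordinate_slices.

Lemma insert_coord_neq (T : Type) n (i k : 'I_n) (s t : T) (z : 'cV[T]_n.-1) :
  k != i -> insert_coord i s z k ord0 = insert_coord i t z k ord0.
Proof.
rewrite eq_sym !mxE => ki; have [j _ ->] := unlift_some ki.
by [].
Qed.

(** * The best approximation by sums of functions of single coordinates *)

Section ridge_projection.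
Context {R : realType}.
Notation L n := (@lebesgue_space R n).
Variables (n r : nat) (ka : 'I_r -> 'I_n.+1) (Y : set (L n.+1))
  (T : 'I_r -> set R) (W : 'I_r -> set (L n)).
Hypotheses (ka_inj : injective ka) (mY : measurable Y)
  (Yfin : (leb n.+1 Y < +oo)%E) (Ypos : (0 < leb n.+1 Y)%E).
Hypothesis YE : forall i t z, Y (insert_coord (ka i) t z) <-> T i t /\ W i z.

Local Notation dotY := (dot (leb n.+1) Y).
Local Notation sqY := (sqint (leb n.+1) Y).
Local Notation w i := (fine (leb n (W i))).
Local Notation vY := (fine (leb n.+1 Y)).
Local Notation P i := (slice_integral (ka i) (W i)).

Lemma vol_slice_neq0 i : w i != 0.
Proof. exact/lt0r_neq0/(vol_slice_gt0 mY Yfin Ypos (YE i)). Qed.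

Lemma vol_neq0 : vY != 0.
Proof. by rewrite gt_eqF// fine_gt0// Ypos. Qed.

Lemma ridge_slice_sqint i u : sqY u -> sqY (fun y => P i u (y (ka i) ord0)).
Proof. exact: (sqint_slice_integral mY Yfin Ypos (YE i)). Qed.

Lemma ridge_slice_dot i u (h : R -> R) : sqY u -> sqY (fun y => h (y (ka i) ord0)) ->
  dotY (fun y => P i u (y (ka i) ord0)) (fun y => h (y (ka i) ord0)) =
  w i * dotY u (fun y => h (y (ka i) ord0)).
Proof. exact: (dot_slice_integral mY Yfin Ypos (YE i)). Qed.

Lemma ridge_sqint1 : sqY (fun=> 1). Proof. exact: sqint_cst. Qed.

Lemma dot_slice_cst i u : sqY u ->
  dotY (fun y => P i u (y (ka i) ord0)) (fun=> 1) = w i * dotY u (fun=> 1).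
Proof. move=> su.
by apply: (ridge_slice_dot (h := fun=> 1)) su _; exact: ridge_sqint1.
Qed.

(* Since the function [P j u] of [y_j] does not depend on [y_i], its own slice
   integral along [y_i] is a constant. *)
Lemma dot_slice_cross i j u (h : R -> R) : i != j -> sqY u ->
  sqY (fun y => h (y (ka i) ord0)) ->
  dotY (fun y => P j u (y (ka j) ord0)) (fun y => h (y (ka i) ord0)) =
  w j * (dotY u (fun=> 1) / vY) * dotY (fun=> 1) (fun y => h (y (ka i) ord0)).
Proof.
move=> ij su sh; pose q (y : L n.+1) : R := P j u (y (ka j) ord0).
have sq : sqY q by exact: ridge_slice_sqint.
have [c Pq] : exists c, forall t, P i q t = c.
  (* The point 0 is arbitrary: [q] ignores the inserted coordinate. *)
  exists (P i q 0) => t; apply: eq_Rintegral => z _; rewrite /q (insert_coord_neq t 0)//.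
  by rewrite (inj_eq ka_inj) eq_sym.
have dotc v : sqY v -> dotY (fun=> c) v = c * dotY (fun=> 1) v.
  move=> sv; rewrite -(dotZl mY c ridge_sqint1 sv).
  by apply: eq_dot => // y _; rewrite mulr1.
(* The constant is found by pairing with 1: c |Y| = w_i <q, 1>, and <q, 1> = w_j <u, 1>. *)
have cE : c = w i * (w j * dotY u (fun=> 1)) / vY.
  apply: (canRL (mulfK vol_neq0)).
  rewrite -(dot_slice_cst j su) -(dot_slice_cst i sq) -(dot11 (leb n.+1) mY).
  rewrite -(dotc _ ridge_sqint1).
  by apply: eq_dot => // y _; rewrite Pq.
have : dotY (fun=> c) (fun y => h (y (ka i) ord0)) =
    w i * dotY q (fun y => h (y (ka i) ord0)).
  by rewrite -ridge_slice_dot//; apply: eq_dot => // y _; rewrite Pq.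
rewrite dotc// cE => H; apply: (mulfI (vol_slice_neq0 i)); rewrite -H.
field; exact: vol_neq0.
Qed.

Variables (F : L n.+1 -> R) (i0 : 'I_r).
Hypothesis sF : sqY F.

Local Notation A := (dotY F (fun=> 1)).

(** The grand mean plus the main effects of [F], as in an analysis of variance. *)
Definition best_ridge (y : L n.+1) : R :=
  \sum_i (w i)^-1 * P i F (y (ka i) ord0) - (r%:R - 1) * (A / vY).

Lemma ridge_slice_sqintZ i : sqY (fun y => (w i)^-1 * P i F (y (ka i) ord0)).
Proof. exact/sqintZ/ridge_slice_sqint. Qed.

Lemma sqint_sum_slices :
  sqY (fun y => \sum_i (w i)^-1 * P i F (y (ka i) ord0)).
Proof. by apply: (sqint_sum mY Yfin) => i; exact: ridge_slice_sqintZ. Qed.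

Lemma sqint_best_ridge : sqY best_ridge.
Proof.
exact: (sqintB mY sqint_sum_slices (sqint_cst mY Yfin _)).
Qed.

Lemma dot_best_ridge v : sqY v -> dotY best_ridge v =
  \sum_i (w i)^-1 * dotY (fun y => P i F (y (ka i) ord0)) v -
  (r%:R - 1) * (A / vY) * dotY (fun=> 1) v.
Proof.
move=> sv.
rewrite [LHS](dotBl mY sqint_sum_slices (sqint_cst mY Yfin _) sv).
rewrite (dot_suml mY Yfin _ ridge_slice_sqintZ sv); congr (_ - _).
  by apply: eq_bigr => i _; rewrite (dotZl mY _ (ridge_slice_sqint i sF) sv).
rewrite -(dotZl mY _ ridge_sqint1 sv); apply: eq_dot => // y _.
by rewrite mulr1.
Qed.

(** Paired with a function h of $y_i$, term i of the sum gives <F, h>. Each of the other r - 1 terms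
    gives (A / |Y|) <1, h>, and the subtracted constant cancels them. *)
Lemma best_ridge_orthogonal i (h : R -> R) : sqY (fun y => h (y (ka i) ord0)) ->
  dotY (fun y => F y - best_ridge y) (fun y => h (y (ka i) ord0)) = 0.
Proof.
move=> sh; rewrite dotBl//; last exact: sqint_best_ridge.
rewrite dot_best_ridge// (bigD1 i)//= ridge_slice_dot// mulKf ?vol_slice_neq0//.
rewrite (eq_bigr (fun=> A / vY * dotY (fun=> 1) (fun y => h (y (ka i) ord0)))).
  rewrite sumr_const cardC1 card_ord -(mulr_natl _ r.-1).
  (* The truncated predecessor is a true difference because the index [i] forces r > 0. *)
  rewrite (_ : r.-1%:R = r%:R - 1 :> R); first by ring.
  by rewrite -subn1 natrB// (leq_ltn_trans (leq0n i)).
by move=> j ji; rewrite dot_slice_cross// 1?eq_sym// !mulrA mulVf ?vol_slice_neq0// mul1r.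
Qed.

(** A ridge sum has no separate constant term, so the constant is charged to the component [i0]. *)
Definition best_ridge_component i (t : R) : R :=
  (w i)^-1 * P i F t - (if i == i0 then (r%:R - 1) * (A / vY) else 0).

Lemma sqint_best_ridge_component i :
  sqY (fun y => best_ridge_component i (y (ka i) ord0)).
Proof.
exact: (sqintB mY (ridge_slice_sqintZ i) (sqint_cst mY Yfin _)).
Qed.

Lemma best_ridgeE y :
  best_ridge y = \sum_i best_ridge_component i (y (ka i) ord0).
Proof.
rewrite /best_ridge_component sumrB; congr (_ - _).
by rewrite -big_mkcond /= big_pred1_eq.
Qed.

Lemma sqint_best_ridgeB : sqY (fun y => F y - best_ridge y).
Proof. exact: (sqintB mY sF sqint_best_ridge). Qed.

Lemma ridge_sum_orthogonal (h : 'I_r -> R -> R) :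
  (forall i, sqY (fun y => h i (y (ka i) ord0))) ->
  dotY (fun y => F y - best_ridge y) (fun y => \sum_i h i (y (ka i) ord0)) = 0.
Proof.
move=> sh; rewrite dotC (dot_suml mY Yfin _ sh sqint_best_ridgeB).
by rewrite big1// => i _; rewrite dotC best_ridge_orthogonal.
Qed.

Lemma best_ridge_self_orthogonal :
  dotY (fun y => F y - best_ridge y) best_ridge = 0.
Proof.
rewrite -(ridge_sum_orthogonal sqint_best_ridge_component).
by apply: eq_dot => // y _; exact: best_ridgeE.
Qed.

(** By orthogonality the squared error is <F - g0, F>. The projection property with h = P_i F
    rewrites <P_i F, F> / w_i as <P_i F, P_i F> / w_i^2. *)
Lemma best_ridge_error :
  dotY (fun y => F y - best_ridge y) (fun y => F y - best_ridge y) =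
  dotY F F
  - \sum_i (w i ^+ 2)^-1 * dotY (fun y => P i F (y (ka i) ord0))
                                (fun y => P i F (y (ka i) ord0))
  + (r%:R - 1) * (A ^+ 2 / vY).
Proof.
rewrite (dotBr mY sF sqint_best_ridge sqint_best_ridgeB).
rewrite best_ridge_self_orthogonal subr0 (dotBl mY sF sqint_best_ridge sF).
rewrite (dot_best_ridge sF) (dotC _ _ (fun=> 1)) opprB addrCA addrC; congr (_ + _).
  congr (_ - _); apply: eq_bigr => i _.
  rewrite (ridge_slice_dot sF (ridge_slice_sqint i sF)) (dotC _ _ F).
  by field; exact: vol_slice_neq0.
by rewrite -mulrA mulrAC expr2.
Qed.

Lemma best_ridge_le (h : 'I_r -> R -> R) :
  (forall i, sqY (fun y => h i (y (ka i) ord0))) ->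
  dotY (fun y => F y - best_ridge y) (fun y => F y - best_ridge y) <=
  dotY (fun y => F y - \sum_i h i (y (ka i) ord0))
       (fun y => F y - \sum_i h i (y (ka i) ord0)).
Proof.
move=> sh; rewrite (dotBr mY sF sqint_best_ridge sqint_best_ridgeB).
rewrite best_ridge_self_orthogonal subr0.
apply: (dot_orthogonal_le mY sF sqint_best_ridge (sqint_sum mY Yfin _ sh)).
  exact: ridge_sum_orthogonal.
exact: best_ridge_self_orthogonal.
Qed.

End ridge_projection.

(** * Transport between [X] and its image under the coordinate map *)

Section coord_map_transport.
Context {R : realType}.
Notation L n := (@lebesgue_space R n).
Variables (n : nat) (b : 'M[R]_n) (X : set (L n)).
Hypotheses (bu : b \in unitmx) (mX : measurable X).
Let Y : set (L n) := coord_map b @` X.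

Lemma coord_map_imageE : Y = (fun y : L n => invmx b *m y : L n) @^-1` X.
Proof.
apply/seteqP; split=> [_ [x Xx <-] | y Xy] /=.
  by rewrite /coord_map mulKmx.
by exists (invmx b *m y) => //; rewrite /coord_map mulKVmx.
Qed.

Lemma coord_map_imageP (x : L n) : Y (coord_map b x) <-> X x.
Proof. by rewrite coord_map_imageE /= /coord_map mulKmx. Qed.

Lemma measurable_coord_map_image : measurable Y.
Proof.
rewrite coord_map_imageE; apply: measurable_lebesgue_linear => //.
by rewrite unitmx_inv.
Qed.

Lemma patch_coord_map (v : L n -> R) :
  (fun x => v (coord_map b x)) \_ X = fun x => (v \_ Y) (coord_map b x).
Proof.
apply/funext => x; rewrite !patchE; congr (if _ then _ else _).
by apply/idP/idP; rewrite !inE => /coord_map_imageP.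
Qed.

Lemma measurable_fun_coord_map (v : L n -> R) :
  measurable_fun X (fun x => v (coord_map b x)) <-> measurable_fun Y v.
Proof.
have mY := measurable_coord_map_image.
split=> mv.
  apply/(measurable_restrictT _ mY).
  have {}mv := (measurable_restrictT _ mX).1 mv.
  have bVu : invmx b \in unitmx by rewrite unitmx_inv.
  have := measurable_fun_lebesgue_linear bVu mv.
  congr measurable_fun; apply/funext => y.
  by rewrite patch_coord_map /coord_map mulKVmx.
apply/(measurable_restrictT _ mX); rewrite patch_coord_map.
apply: (measurable_fun_lebesgue_linear bu).
exact/(measurable_restrictT _ mY).1.
Qed.

Lemma integral_sqr_coord_map (v : L n -> R) : measurable_fun Y v ->
  (\int[leb n]_(x in X) (v (coord_map b x) ^+ 2)%:E =
   `|\det b|^-1%:E * \int[leb n]_(y in Y) (v y ^+ 2)%:E)%E.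
Proof.
move=> /(measurable_restrictT _ measurable_coord_map_image) mv.
rewrite integral_mkcond [in RHS]integral_mkcond.
pose u (y : L n) : R := (v \_ Y) y ^+ 2.
transitivity (\int[leb n]_x (u (coord_map b x))%:E)%E.
  apply: eq_integral => x _; rewrite restrict_EFin /= -patch_sqr.
  by rewrite patch_coord_map.
rewrite (ge0_integral_lebesgue_linear bu (u := u)); first last.
- by move=> y; exact: sqr_ge0.
- exact: measurable_funX.
congr (_ * _)%E; apply: eq_integral => y _.
by rewrite restrict_EFin /= -patch_sqr.
Qed.

(** In this form square integrability passes between [X] and [Y] by the formula for the integrals of
    squares. *)
Lemma sqintP (D : set (L n)) (v : L n -> R) :
  sqint (leb n) D v <-> measurable_fun D v /\
    (\int[leb n]_(y in D) (v y ^+ 2)%:E < +oo)%E.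
Proof.
have E : (\int[leb n]_(y in D) `|(v y ^+ 2)%:E| =
    \int[leb n]_(y in D) (v y ^+ 2)%:E)%E.
  by apply: eq_integral => y _; rewrite gee0_abs// lee_fin sqr_ge0.
split=> -[mv iv]; split=> //.
  by rewrite -E; have /integrableP[] := iv.
apply/integrableP; split; last by rewrite E.
by apply/measurable_EFinP; exact: measurable_funX.
Qed.

Let det_gt0 : 0 < `|\det b|^-1.
Proof. by rewrite invr_gt0 normr_gt0 -unitfE -unitmxE. Qed.

Lemma sqint_coord_map (v : L n -> R) :
  sqint (leb n) X (fun x => v (coord_map b x)) <-> sqint (leb n) Y v.
Proof.
rewrite !sqintP measurable_fun_coord_map; split=> -[mv]; rewrite integral_sqr_coord_map//.
  move=> H; split=> //; move: H; rewrite !ltey; apply: contra_neq => ->.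
  by rewrite gt0_muley// lte_fin.
by move=> H; split=> //; rewrite lte_mul_pinfty// lee_fin ltW.
Qed.

Lemma dot_coord_map (v : L n -> R) : sqint (leb n) Y v ->
  dot (leb n) X (fun x => v (coord_map b x)) (fun x => v (coord_map b x)) =
  `|\det b|^-1 * dot (leb n) Y v v.
Proof.
move=> sv; have mY := measurable_coord_map_image.
have sX := (sqint_coord_map v).2 sv.
apply: EFin_inj; rewrite EFinM (dotEFin mX sX) (dotEFin mY sv).
by rewrite integral_sqr_coord_map//; case: sv.
Qed.

Lemma leb_coord_map : (leb n X = `|\det b|^-1%:E * leb n Y)%E.
Proof.
have := @integral_sqr_coord_map (cst 1) (measurable_cst _).
have E (D : set (L n)) : measurable D ->
    (\int[leb n]_(x in D) (cst 1 (x : L n) ^+ 2)%:E = leb n D)%E.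
  move=> mD; under eq_integral do rewrite expr1n.
  by rewrite integral_cst// mul1e.
by rewrite (E _ measurable_coord_map_image) (E _ mX).
Qed.

End coord_map_transport.

(** * The r-set as a product in each ridge coordinate, and the error formula *)

Lemma dotv_row (R : realType) m n (b : 'M[R]_(m, n)) (k : 'I_m) (x : 'cV[R]_n) :
  dotv (row k b) x = (b *m x) k ord0.
Proof. by rewrite /dotv -row_mul mxE. Qed.

Lemma rset_product_insert (R : realType) n r (r_le_n : (r <= n)%N)
    (Ys : 'I_r -> set R) (Y0 : set 'cV[R]_(n - r)) (i : 'I_r) (t : R)
    (z : 'cV[R]_n.-1) :
  rset_product r_le_n Ys Y0 (insert_coord (widen_ord r_le_n i) t z) <->
  Ys i t /\ rset_product_omit r_le_n Ys Y0 i z.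
Proof.
have widen_neq (j : 'I_r) : j != i -> widen_ord r_le_n j != widen_ord r_le_n i.
  by rewrite -!val_eqE.
have ins_i : insert_coord (widen_ord r_le_n i) t z (widen_ord r_le_n i) ord0 = t.
  by rewrite mxE unlift_none.
(* Tail coordinates have index at least r, hence differ from the inserted one. *)
have tailE : tail_coords r_le_n (insert_coord (widen_ord r_le_n i) t z) =
    tail_coords r_le_n (insert_coord (widen_ord r_le_n i) 0 z).
  apply/colP => k; rewrite [LHS]mxE [RHS]mxE; apply: insert_coord_neq.
  by rewrite -val_eqE /= gtn_eqF// (leq_trans (ltn_ord i)) ?leq_addr.
rewrite /rset_product /rset_product_omit /= tailE; split.
  move=> [H1 H2]; split; first by rewrite -[X in Ys i X]ins_i.
  split; last exact: H2.
  by move=> j ji; rewrite (insert_coord_neq _ t _ (widen_neq _ ji)); exact: H1.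
move=> [Yt [H1 H2]]; split; last exact: H2.
move=> j; have [->|ji] := eqVneq j i; first by rewrite ins_i.
by rewrite (insert_coord_neq _ 0 _ (widen_neq _ ji)); exact: H1.
Qed.

Theorem theorem1p14 (R : realType) (n r : nat)
    (r_gt0 : (0 < r)%N) (r_le_n : (r <= n)%N)
    (a : 'M[R]_(r, n)) (a_free : row_free a)
    (b : 'M[R]_n) (b_basis : row_free b && row_full b)
    (b_completes_a : forall i : 'I_r, row (widen_ord r_le_n i) b = row i a)
    (X : set 'cV[R]_n) (X_measurable : lebesgue_measurable X)
    (X_gt0 : (0 < leb n X)%E) (X_fin : (leb n X < +oo)%E)
    (f : 'cV[R]_n -> R) (f_L2 : L2 X f)
    (Y0 : set 'cV[R]_(n - r))
    (Y_rset : coord_map b @` X = rset_product r_le_n (projections a X) Y0) :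
  let Y := coord_map b @` X in
  let Yo := rset_product_omit r_le_n (projections a X) Y0 in
  let F := pullback b f in
  let A := integral_over Y F in
  let Fi i := marginal r_le_n i (Yo i) F in
  approx_error a X f =
  ((Num.sqrt `|\det b|)^-1 *
   Num.sqrt
     (fine (L2norm Y F) ^+ 2
      - \sum_(i < r) (vol (Yo i) ^+ 2)^-1 *
          fine (L2norm Y (fun y => Fi i (y (widen_ord r_le_n i) ord0))) ^+ 2
      + (r%:R - 1) * (A ^+ 2 / vol Y)))%:E.
Proof.
(* Dimension 0 is excluded by 0 < r <= n; slicing needs a dimension of successor form. *)
case: n r_le_n a a_free b b_basis b_completes_a X X_measurable X_gt0 X_fin f
  f_L2 Y0 Y_rset => [|m] r_le_n a a_free b b_basis b_completes_a X X_measurable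
  X_gt0 X_fin f f_L2 Y0 Y_rset.
  by have := leq_trans r_gt0 r_le_n.
move=> Y Yo F A Fi.
pose ka (i : 'I_r) : 'I_m.+1 := widen_ord r_le_n i.
have ka_inj : injective ka by move=> i j /(congr1 val) /= /val_inj.
have bu : b \in unitmx by case/andP: b_basis; rewrite row_free_unit.
have mX : measurable (X : set (lebesgue_space m.+1)) := X_measurable.
have mY : measurable (Y : set (lebesgue_space m.+1)).
  exact: measurable_coord_map_image.
have XY : leb m.+1 X = (`|\det b|^-1%:E * leb m.+1 Y)%E by exact: leb_coord_map.
have Ypos : (0 < leb m.+1 Y)%E.
  rewrite measure_gt0; apply: contraTneq X_gt0 => Y0_eq.
  by rewrite XY Y0_eq mule0 ltxx.
have det_gt0 : 0 < `|\det b|^-1.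
  by rewrite invr_gt0 normr_gt0 -unitfE -unitmxE.
have Yfin : (leb m.+1 Y < +oo)%E.
  move: X_fin; rewrite XY !ltey; apply: contra_neq => ->.
  by rewrite gt0_muley// lte_fin.
have YE (i : 'I_r) t z : Y (insert_coord (ka i) t z) <->
    projections a X i t /\ Yo i z.
  by rewrite /Y Y_rset; exact: rset_product_insert.
have FE x : F (coord_map b x) = f x by rewrite /F /pullback mulKmx.
have sF : sqint (leb m.+1) Y F.
  apply/(sqint_coord_map bu mX); have := (L2P f mX).1 f_L2.
  by apply: (sqint_eq mX) => x _; rewrite FE.
pose g0 := best_ridge ka Y Yo F.
have s0 : sqint (leb m.+1) Y g0 by exact: (sqint_best_ridge mY Yfin Ypos YE sF).
have dotvE i x : dotv (row i a) x = coord_map b x (ka i) ord0.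
  by rewrite -b_completes_a dotv_row.
have normE (G : 'cV[R]_m.+1 -> R) : sqint (leb m.+1) Y G ->
    L2norm X (fun x => f x - G (coord_map b x)) =
    (Num.sqrt (`|\det b|^-1 *
      dot (leb m.+1) Y (fun y => F y - G y) (fun y => F y - G y)))%:E.
  move=> sG; pose v (y : 'cV[R]_m.+1) : R := F y - G y.
  have sv : sqint (leb m.+1) Y v := sqintB mY sF sG.
  have -> : (fun x => f x - G (coord_map b x)) = fun x => v (coord_map b x).
    by apply/funext => x; rewrite /v FE.
  by rewrite (L2normE mX ((sqint_coord_map bu mX v).2 sv)) (dot_coord_map bu mX sv).
pose e := dot (leb m.+1) Y (fun y => F y - g0 y) (fun y => F y - g0 y).
(* The infimum is attained at [g0] composed with [b]. Every ridge sum on [X] is likewise a sum of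
   functions of single coordinates on [Y], composed with [b], so none does better. *)
transitivity (Num.sqrt (`|\det b|^-1 * e))%:E.
  apply/eqP; rewrite eq_le; apply/andP; split.
    rewrite -(normE _ s0); apply: ereal_inf_lbound.
    exists (fun x => g0 (coord_map b x)) => //.
    (* The first ridge function carries the constant; it exists because r > 0. *)
    exists (best_ridge_component ka Y Yo F (Ordinal r_gt0)) => [i|].
      apply/(L2P _ mX); under eq_fun do rewrite dotvE.
      apply: (sqint_coord_map bu mX (fun y : 'cV[R]_m.+1 =>
        best_ridge_component ka Y Yo F (Ordinal r_gt0) i (y (ka i) ord0))).2.
      exact: (sqint_best_ridge_component mY Yfin Ypos YE).
    apply/funext => x; under eq_bigr do rewrite dotvE.
    exact: best_ridgeE.
  apply: le_ereal_inf_tmp => _ [_ [h hL2 ->] <-].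
  have sh i : sqint (leb m.+1) Y (fun y => h i (y (ka i) ord0)).
    apply: (sqint_coord_map bu mX (fun y : 'cV[R]_m.+1 => h i (y (ka i) ord0))).1.
    have := (L2P _ mX).1 (hL2 i).
    by apply: (sqint_eq mX) => x _; rewrite dotvE.
  pose G (y : 'cV[R]_m.+1) : R := \sum_(i < r) h i (y (ka i) ord0).
  have sG : sqint (leb m.+1) Y G by exact: (sqint_sum mY Yfin _ sh).
  have -> : (fun x => f x - \sum_(i < r) h i (dotv (row i a) x)) =
      fun x => f x - G (coord_map b x).
    apply/funext => x; congr (_ - _).
    by apply: eq_bigr => i _; rewrite dotvE.
  rewrite (normE G sG).
  rewrite lee_fin ler_wsqrtr// ler_wpM2l ?(ltW det_gt0)//.
  exact: (best_ridge_le ka_inj mY Yfin Ypos YE (Ordinal r_gt0) sF sh).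
congr EFin; rewrite sqrtrM ?(ltW det_gt0)// sqrtrV//; congr (_ * Num.sqrt _).
have sqE (v : 'cV[R]_m.+1 -> R) : sqint (leb m.+1) Y v ->
    fine (L2norm Y v) ^+ 2 = dot (leb m.+1) Y v v.
  by move=> sv; rewrite (L2normE mY sv) /= sqr_sqrtr ?dot_ge0.
rewrite /e /g0 (best_ridge_error ka_inj mY Yfin Ypos YE (Ordinal r_gt0) sF).
rewrite (sqE F sF); congr (_ - _ + _ * (_ ^+ 2 / _)).
  apply: eq_bigr => i _; congr (_ * _); apply/esym/sqE.
  exact: (sqint_slice_integral mY Yfin Ypos (YE i) sF).
(* The remaining goal identifies <F, 1> with the integral [A]. *)
by apply: eq_Rintegral => y _; rewrite mulr1.
Qed.
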